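(* Let $T\in\mathcal C(H)$ be symmetric, and let $n\in\mathbb N$ be fixed. Then $$\theta(T,nI)=\frac{1}{\sqrt{1+n^2}}\max\left\{\left\|(T-nI)(I+T^*T)^{-\frac12}\right\|,\ \left\|(T^*-nI)(I+TT^* )^{-\frac12}\right\|\right\}.$$ In particular, if $T=T^*$, then $$\theta(T,nI)=\frac{\left\|(T-nI)(I+T^2)^{-\frac12}\right\|}{\sqrt{1+n^2}}.$$ Furthermore, if $-\frac1n\in\sigma(T)$, then $\theta(T,nI)=1$.
   Context: $H$ is an infinite dimensional complex Hilbert space. $\mathcal C(H)$ denotes the class of densely defined closed linear operators with dense domain $D(T)\subseteq H$ and values in $H$. $T$ is symmetric if $T\subseteq T^*$ (that is, $D(T)\subseteq D(T^* )$ and $T^*x=Tx$ for $x\in D(T)$). $\mathbb N=\{1,2,3,\dots\}$ and $I$ is the identity operator on $H$. For $S,T\in\mathcal C(H)$ the gap is $\theta(S,T):=\|P_{G(S)}-P_{G(T)}\|$, where $P_{G(T)}$ is the orthogonal projection of $H\times H$ onto the closed subspace $G(T)=\{(x,Tx):x\in D(T)\}$. The spectrum $\sigma(T)$ is the complement in $\mathbb C$ of the set of $\lambda$ such that $T-\lambda I:D(T)\to H$ is invertible with $(T-\lambda I)^{-1}$ a bounded operator on $H$. *)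

(* Defs.v *)
From HB Require Import structures.
From mathcomp Require Import all_boot all_order all_algebra.
From mathcomp Require Import all_classical all_reals all_analysis.
From mathcomp Require Import complex.
Set Implicit Arguments.
Unset Strict Implicit.
Unset Printing Implicit Defensive.
Import Order.TTheory GRing.Theory Num.Theory.
Import numFieldNormedType.Exports.
Local Open Scope classical_set_scope.
Local Open Scope ring_scope.
Local Open Scope complex_scope.

(* A complex Hilbert space: a Banach space over R[i] whose norm comes from an
   inner product, linear in the first argument and antilinear in the second. *)
HB.mixin Record isHilbert (R : realType) H of CompleteNormedModule R[i] H := {
  inner : {dot H for Num.conj} ;
  inner_norm : forall x : H, inner x x = `|x| ^+ 2
}.

#[short(type="hilbertType")]
HB.structure Definition Hilbert (R : realType) :=
  {H of isHilbert R H & CompleteNormedModule R[i] H}.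

Definition infinite_dimensional (R : realType) (H : hilbertType R) : Prop :=
  ~ exists (m : nat) (v : 'I_m -> H),
      forall x : H, exists c : 'I_m -> R[i], x = \sum_(i < m) c i *: v i.

(* A partially defined map V -> V.  The value of [app] outside [dom] is junk:
   two operators are compared with [leop] and [eqop], not with Leibniz
   equality. *)
Record operator (V : Type) := Operator { dom : set V ; app :> V -> V }.

Definition total (V : Type) (f : V -> V) : operator V := Operator setT f.

Definition graph (V : Type) (T : operator V) : set (V * V) :=
  [set (x, T x) | x in dom T].

Definition leop (V : Type) (S T : operator V) : Prop :=
  dom S `<=` dom T /\ (forall x, dom S x -> T x = S x).

Definition eqop (V : Type) (S T : operator V) : Prop :=
  leop S T /\ leop T S.

(* The norm takes its values in the extended reals; it is +oo exactly for
   unbounded operators. *)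
Definition opnorm (R : realType) (V : Type) (nrm : V -> R) (T : operator V) :
    \bar R :=
  ereal_sup [set (nrm (T x))%:E | x in [set x | dom T x /\ nrm x <= 1]].

Section Operators.
Variables (R : realType) (H : hilbertType R).
Implicit Types (S T A B : operator H).

(* The norm of a normed module over R[i] takes its values in R[i]. *)
Definition hnorm (x : H) : R := complex.Re `|x|.

Definition scalarop (a : R[i]) : operator H := total (fun x => a *: x).

Definition addop S T : operator H :=
  Operator (dom S `&` dom T) (fun x => S x + T x).

Definition subop S T : operator H :=
  Operator (dom S `&` dom T) (fun x => S x - T x).

Definition mulop S T : operator H :=
  Operator [set x | dom T x /\ dom S (T x)] (fun x => S (T x)).

Definition invop T : operator H :=
  Operator (T @` dom T) (fun y => xget 0 [set x | dom T x /\ T x = y]).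

Definition adjoint_value T (y : H) : set H :=
  [set z | forall x, dom T x -> inner (T x) y = inner x z].

Definition adjoint T : operator H :=
  Operator [set y | adjoint_value T y !=set0]
           (fun y => xget 0 (adjoint_value T y)).

Definition linear_operator T : Prop :=
  dom T 0 /\
  forall (a : R[i]) x y, dom T x -> dom T y ->
    dom T (a *: x + y) /\ T (a *: x + y) = a *: T x + T y.

(* The class C(H). *)
Definition closed_densely_defined T : Prop :=
  [/\ linear_operator T, dense (dom T) & closed (graph T)].

Definition symmetric_operator T : Prop := leop T (adjoint T).

Definition selfadjoint T : Prop := eqop T (adjoint T).

Definition bounded_operator T : Prop :=
  [/\ dom T = setT, linear_operator T & (opnorm hnorm T < +oo)%E].

(* In R[i], 0 <= z means that z is real and nonnegative. *)
Definition positive_operator T : Prop :=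
  forall x, dom T x -> 0 <= inner (T x) x.

Definition is_sqrtop B A : Prop :=
  [/\ bounded_operator A, positive_operator A & eqop (mulop A A) B].

(* The positive square root of a positive bounded operator. *)
Definition sqrtop B : operator H :=
  total (xget (fun=> 0) [set a : H -> H | is_sqrtop B (total a)]).

(* B^(-1/2), as the positive square root of B^(-1). *)
Definition invsqrtop B : operator H := sqrtop (invop B).

Definition resolvent_set T : set R[i] :=
  [set l | set_inj (dom T) (subop T (scalarop l)) /\
           bounded_operator (invop (subop T (scalarop l)))].

Definition spectrum T : set R[i] := ~` resolvent_set T.

(* The Hilbert space structure of H x H; the norm carried by the product type
   in the library is the max norm, which induces the same topology. *)
Definition pinner (p q : H * H) : R[i] := inner p.1 q.1 + inner p.2 q.2.

Definition pnorm (p : H * H) : R :=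
  Num.sqrt (hnorm p.1 ^+ 2 + hnorm p.2 ^+ 2).

(* The orthogonal projection of H x H onto M, for a closed subspace M. *)
Definition orthoproj (M : set (H * H)) (p : H * H) : H * H :=
  xget 0 [set q | M q /\ forall r, M r -> pinner (p - q) r = 0].

Definition gap S T : \bar R :=
  opnorm pnorm
    (total (fun p => orthoproj (graph S) p - orthoproj (graph T) p)).

End Operators.

Arguments scalarop {R} H a.

(* Main.v *)
(* Let S = T^*.  The operator A = (I + S T)^(-1/2) turns into an isometry
   x |-> (A x, T A x) of H onto the graph of T, because
   |A x|^2 + |T A x|^2 = <(I + S T) A x, A x> = |x|^2 whenever x is in the dense
   range of A; hence |(T - n I) A| is the supremum of |v - n u| over (u, v) in
   the unit ball of the graph of T.
   Since |v - n u| / sqrt (1 + n^2) is the distance from (u, v) to the graph of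
   n I, and the rotation (v, z) |-> (- z, v) sends the graph of S onto the
   orthogonal complement of the graph of T and the graph of n I onto its own
   complement, the formula is |P - Q| = max (|(1 - Q) P|, |Q (1 - P)|) for the
   projections P, Q onto the two graphs.  If |P - Q| < 1, the other component
   |u + n v| is bounded below on both graphs, which makes T + 1/n boundedly
   invertible. *)
From HB Require Import structures.
Require Import Defs.
From mathcomp Require Import all_boot all_order all_algebra.
From mathcomp Require Import all_classical all_reals all_analysis.
From mathcomp Require Import complex.
From mathcomp Require Import ring lra.
Import Order.TTheory GRing.Theory Num.Theory.
Import numFieldNormedType.Exports.
Local Open Scope classical_set_scope.
Local Open Scope ring_scope.
Local Open Scope complex_scope.

Set Implicit Arguments.
Unset Strict Implicit.
Unset Printing Implicit Defensive.

(** * Sesquilinear inner products *)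

Section ComplexParts.
Variable R : realType.
Implicit Types (z w : R[i]) (t : R).

Lemma ReD z w : complex.Re (z + w) = complex.Re z + complex.Re w.
Proof. by case: z; case: w. Qed.

Lemma ReN z : complex.Re (- z) = - complex.Re z.
Proof. by case: z. Qed.

Lemma ReZ t z : complex.Re (t%:C * z) = t * complex.Re z.
Proof. by case: z => a b /=; rewrite mul0r subr0. Qed.

Lemma Re_conjc z : complex.Re (Num.conj z) = complex.Re z.
Proof. by case: z. Qed.

Lemma Re_real_complex t : complex.Re t%:C = t.
Proof. by []. Qed.

Lemma conj_real_complex t : Num.conj t%:C = t%:C.
Proof. exact: conjc_real. Qed.

(** The modulus on [R[i]] is itself an element of [R[i]]; its real part is the modulus as a real
    number, the form used in all estimates below. *)
Lemma Re_norm_ge0 z : 0 <= complex.Re `|z|.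
Proof. by rewrite normc_def sqrtr_ge0. Qed.

Lemma Re_normK z : (complex.Re `|z|)%:C = `|z|.
Proof. by rewrite normc_def. Qed.

Lemma Re_norm_sqr z : ((complex.Re `|z|) ^+ 2)%:C = z * Num.conj z.
Proof. by rewrite rmorphXn /= Re_normK normCK. Qed.

Lemma Re_norm_eq0 z : complex.Re `|z| = 0 -> z = 0.
Proof.
by move=> z0; apply/eqP; rewrite -normr_eq0 -Re_normK z0.
Qed.

Lemma Re_normD z w :
  complex.Re `|z + w| <= complex.Re `|z| + complex.Re `|w|.
Proof. by rewrite -lecR rmorphD /= !Re_normK ler_normD. Qed.

Lemma Re_norm_cvg_unique (c : nat -> R[i]) z w :
  complex.Re `|c k - z| @[k --> \oo] --> (0 : R) ->
  complex.Re `|c k - w| @[k --> \oo] --> (0 : R) -> z = w.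
Proof.
move=> cz cw; apply/eqP; rewrite -subr_eq0; apply/eqP/Re_norm_eq0.
apply/le_anti/andP; split; last exact: Re_norm_ge0.
have h : complex.Re `|c k - z| + complex.Re `|c k - w| @[k --> \oo] --> (0 : R).
  by rewrite -[0]addr0; exact: cvgD cz cw.
apply: (ler_cvg_to (cvg_cst _) h); apply: nearW => k.
by rewrite -(subrKA (c k)) -[`|c k - z|]distrC Re_normD.
Qed.

End ComplexParts.

(** * Norm, Cauchy-Schwarz inequality and convergence for an inner product *)

Section DotProduct.
Variables (R : realType) (V : lmodType R[i]) (f : {dot V for Num.conj}).
Implicit Types (x y z : V) (a : R[i]) (u v : nat -> V) (M : set V).

(** Derived from the form alone, so that the same results serve [H] and [H * H], whose library norm
    is the max norm. *)
Definition dotnorm x : R := Num.sqrt (complex.Re (f x x)).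

Local Notation N := dotnorm.

Lemma dotC x y : f x y = Num.conj (f y x).
Proof. by rewrite hermC expr0 mul1r. Qed.

Lemma dot_eq0C x y : f x y = 0 -> f y x = 0.
Proof. by rewrite dotC => h; rewrite -[f y x]conjCK h rmorph0. Qed.

Lemma dotZl a x y : f (a *: x) y = a * f x y.
Proof. by rewrite linearZl_LR. Qed.

Lemma dotZr a x y : f x (a *: y) = Num.conj a * f x y.
Proof. by rewrite linearZr_LR. Qed.

Lemma dotDl x y z : f (x + y) z = f x z + f y z.
Proof. exact: linearDl. Qed.

Lemma dotDr x y z : f x (y + z) = f x y + f x z.
Proof. exact: linearDr. Qed.

Lemma dotBl x y z : f (x - y) z = f x z - f y z.
Proof. exact: linearBl. Qed.

Lemma dotBr x y z : f x (y - z) = f x y - f x z.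
Proof. exact: linearBr. Qed.

Lemma dotNr x y : f x (- y) = - f x y.
Proof. exact: linearNr. Qed.

Lemma dotNl x y : f (- x) y = - f x y.
Proof. exact: linearNl. Qed.

Lemma dot0l x : f 0 x = 0.
Proof. exact: linear0l. Qed.

Lemma dot0r x : f x 0 = 0.
Proof. exact: linear0r. Qed.

Lemma dotnorm_ge0 x : 0 <= N x.
Proof. exact: sqrtr_ge0. Qed.

Lemma dotE x : f x x = (N x ^+ 2)%:C.
Proof.
have fx_ge0 : 0 <= f x x by exact: dnorm_ge0.
rewrite sqr_sqrtr ?RRe_real ?ger0_real//.
by move: fx_ge0; rewrite lecE => /andP[].
Qed.

Lemma Re_dotE x : complex.Re (f x x) = N x ^+ 2.
Proof. by rewrite dotE. Qed.

Lemma dotnorm_eq0 x : N x = 0 -> x = 0.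
Proof.
by move=> x0; apply/eqP; rewrite -(dnorm_eq0 f) dotE x0 expr0n.
Qed.

Lemma dotnorm0 : N 0 = 0.
Proof. by rewrite /N linear0l sqrtr0. Qed.

Lemma dotnorm_gt0 x : x != 0 -> 0 < N x.
Proof.
move=> x0; rewrite lt_def dotnorm_ge0 andbT.
by apply: contra x0 => /eqP/dotnorm_eq0 ->.
Qed.

Lemma dotnormZ a x : N (a *: x) = complex.Re `|a| * N x.
Proof.
rewrite /N dnormZ -[`|a|]Re_normK -rmorphXn/= ReZ sqrtrM ?sqr_ge0//.
by rewrite sqrtr_sqr ger0_norm// Re_norm_ge0.
Qed.

Lemma dotnormZR (t : R) x : N (t%:C *: x) = `|t| * N x.
Proof. by rewrite dotnormZ normc_def /= expr0n /= addr0 sqrtr_sqr. Qed.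

Lemma dotnormN x : N (- x) = N x.
Proof. by rewrite /N hnormN. Qed.

Lemma dotnormBC x y : N (x - y) = N (y - x).
Proof. by rewrite -dotnormN opprB. Qed.

Lemma dotnormD_sqr x y :
  N (x + y) ^+ 2 = N x ^+ 2 + N y ^+ 2 + 2 * complex.Re (f x y).
Proof. rewrite -!Re_dotE dnormD !ReD Re_conjc; ring. Qed.

Lemma dotnormB_sqr x y :
  N (x - y) ^+ 2 = N x ^+ 2 + N y ^+ 2 - 2 * complex.Re (f x y).
Proof. by rewrite dotnormD_sqr dotnormN linearNr ReN mulrN. Qed.

Lemma dotnormD_orth x y : f x y = 0 -> N (x + y) ^+ 2 = N x ^+ 2 + N y ^+ 2.
Proof. by move=> xy; rewrite dotnormD_sqr xy /= mulr0 addr0. Qed.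

(** Expand the square of the norm of [(N y) x - (N x) y], which is nonnegative, and divide by
    [2 (N x) (N y)]. *)
Lemma dot_Re_le x y : complex.Re (f x y) <= N x * N y.
Proof.
have [->|/dotnorm_gt0 x0] := eqVneq x 0.
  by rewrite linear0l dotnorm0 mul0r.
have [->|/dotnorm_gt0 y0] := eqVneq y 0.
  by rewrite linear0r dotnorm0 mulr0.
have := sqr_ge0 (N ((N y)%:C *: x - (N x)%:C *: y)).
rewrite dotnormB_sqr !dotnormZR !ger0_norm ?dotnorm_ge0//.
rewrite dotZl dotZr ReZ conj_real_complex ReZ => h.
rewrite -(ler_pM2l (mulr_gt0 x0 y0)); nra.
Qed.

(** Turning [y] into [f x y *: y] makes the inner product equal to the squared modulus of [f x y],
    so the bound on real parts applies. *)
Lemma dot_norm_le x y : complex.Re `|f x y| <= N x * N y.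
Proof.
have [->|n0] := eqVneq (f x y) 0.
  by rewrite normr0 mulr_ge0 ?dotnorm_ge0.
have n1 : 0 < complex.Re `|f x y|.
  rewrite lt_def Re_norm_ge0 andbT.
  by apply: contra n0 => /eqP/Re_norm_eq0 ->.
have := dot_Re_le x (f x y *: y).
rewrite dotZr mulrC -Re_norm_sqr dotnormZ Re_real_complex => h.
rewrite -(ler_pM2l n1); nra.
Qed.

Lemma dotnormD x y : N (x + y) <= N x + N y.
Proof.
rewrite -(@ler_pXn2r _ 2%N)// ?nnegrE ?addr_ge0 ?dotnorm_ge0//.
rewrite dotnormD_sqr; have := dot_Re_le x y; nra.
Qed.

Lemma dotnormB_trans z x y : N (x - y) <= N (x - z) + N (z - y).
Proof. by rewrite -[x - y](subrKA z) dotnormD. Qed.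

Lemma dotnorm_dist x y : `|N x - N y| <= N (x - y).
Proof.
have := dotnormD (x - y) y; rewrite subrK => h1.
have := dotnormD (y - x) x; rewrite subrK dotnormBC => h2.
rewrite ler_norml; lra.
Qed.

Definition dot_cvg u x := N (u k - x) @[k --> \oo] --> (0 : R).

Definition dot_cauchy u :=
  forall e : R, 0 < e -> exists K, forall i j, (K <= i)%N -> (K <= j)%N ->
    N (u i - u j) < e.

Definition dot_complete := forall u, dot_cauchy u -> exists x, dot_cvg u x.

Lemma dot_cvg_le u x (b : nat -> R) : (forall k, N (u k - x) <= b k) ->
  b k @[k --> \oo] --> (0 : R) -> dot_cvg u x.
Proof.
move=> ub b0; apply: squeeze_cvgr (cvg_cst 0) b0.
by apply: nearW => k; rewrite dotnorm_ge0 ub.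
Qed.

Lemma dot_cvg_norm u x : dot_cvg u x -> N (u k) @[k --> \oo] --> N x.
Proof.
move=> ux; apply/cvgrPdist_le => e e0.
move/cvgrPdist_le : ux => /(_ e e0); apply: filterS => k.
rewrite sub0r normrN ger0_norm ?dotnorm_ge0// => uk.
by rewrite distrC; exact: le_trans (dotnorm_dist _ _) uk.
Qed.

Lemma dot_cvg_dotl u x y : dot_cvg u x ->
  complex.Re `|f (u k) y - f x y| @[k --> \oo] --> (0 : R).
Proof.
move=> ux.
have h : N (u k - x) * N y @[k --> \oo] --> (0 : R).
  by rewrite -[0](mul0r (N y)); exact: cvgM ux (cvg_cst _).
apply: squeeze_cvgr (cvg_cst 0) h; apply: nearW => k.
by rewrite Re_norm_ge0 -linearBl dot_norm_le.
Qed.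

Lemma dot_cvg_dotr u x y : dot_cvg u x ->
  complex.Re `|f y (u k) - f y x| @[k --> \oo] --> (0 : R).
Proof.
move=> ux.
have h : N y * N (u k - x) @[k --> \oo] --> (0 : R).
  by rewrite -[0](mulr0 (N y)); exact: cvgM (cvg_cst _) ux.
apply: squeeze_cvgr (cvg_cst 0) h; apply: nearW => k.
by rewrite Re_norm_ge0 -dotBr dot_norm_le.
Qed.

Lemma dot_cvg_unique u x y : dot_cvg u x -> dot_cvg u y -> x = y.
Proof.
move=> ux uy; apply/eqP; rewrite -subr_eq0; apply/eqP/dotnorm_eq0.
apply/le_anti/andP; split; last exact: dotnorm_ge0.
have h : N (u k - x) + N (u k - y) @[k --> \oo] --> (0 : R).
  by rewrite -[0]addr0; exact: cvgD ux uy.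
apply: (ler_cvg_to (cvg_cst _) h); apply: nearW => k.
by rewrite [N (u k - x)]dotnormBC dotnormB_trans.
Qed.

(** * Orthogonal projection by minimizing sequences *)

Definition linear_subspace M :=
  M 0 /\ forall a x y, M x -> M y -> M (a *: x + y).

Lemma subspaceD M x y : linear_subspace M -> M x -> M y -> M (x + y).
Proof. by move=> [_ hM] Mx My; rewrite -[x]scale1r; exact: hM. Qed.

Lemma subspaceZ M a x : linear_subspace M -> M x -> M (a *: x).
Proof. by move=> [M0 hM] Mx; rewrite -[_ *: _]addr0; exact: hM. Qed.

Lemma subspaceB M x y : linear_subspace M -> M x -> M y -> M (x - y).
Proof. by move=> [_ hM] Mx My; rewrite addrC -scaleN1r; exact: hM. Qed.

Lemma orth_of_min x y : (forall t : R, N x <= N (x - t%:C *: y)) ->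
  complex.Re (f x y) = 0.
Proof.
move=> h; set b := complex.Re (f x y); pose c := N y ^+ 2 + 1.
have c0 : 0 < c by rewrite ltr_wpDl ?sqr_ge0.
have := h (b / c).
rewrite -(@ler_pXn2r _ 2%N)// ?nnegrE ?dotnorm_ge0// dotnormB_sqr.
rewrite dotZr conj_real_complex ReZ dotnormZR exprMn real_normK ?num_real// -/b.
rewrite -[N y ^+ 2](addrK 1) -/c => {}h.
have : b ^+ 2 * (c + 1) <= 0.
  have : b ^+ 2 * (c + 1) / c ^+ 2 <= 0.
    have -> : b ^+ 2 * (c + 1) / c ^+ 2 =
        - ((b / c) ^+ 2 * (c - 1) - 2 * (b / c * b)).
      by field; rewrite gt_eqF.
    rewrite oppr_le0; lra.
  by rewrite pmulr_lle0// invr_gt0 exprn_gt0.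
have c1 : 0 < c + 1 by rewrite addr_gt0.
rewrite (pmulr_lle0 _ c1) => b0.
by apply/eqP; rewrite -sqrf_eq0 eq_le b0 sqr_ge0.
Qed.

(** The real part of [f x ('i *: y)] is the imaginary part of [f x y]. *)
Lemma dot_eq0 x M : linear_subspace M ->
  (forall y, M y -> complex.Re (f x y) = 0) -> forall y, M y -> f x y = 0.
Proof.
move=> subM h y My; have := h _ (subspaceZ 'i%C subM My).
rewrite dotZr; have := h _ My.
by case: (f x y) => b c /= -> ; rewrite mul0r mulN1r opprK add0r => ->.
Qed.

(** Parallelogram law: the midpoint of [u i] and [u j] lies in [M], hence at squared distance at
    least [d] from [p], which leaves less than [2 / i.+1 + 2 / j.+1] for the squared distance of
    [u i] and [u j]. *)
Lemma dist_minimizing_cauchy M p d u : linear_subspace M ->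
  (forall x, M x -> d <= N (p - x) ^+ 2) ->
  (forall k, M (u k) /\ N (p - u k) ^+ 2 < d + k.+1%:R^-1) -> dot_cauchy u.
Proof.
move=> subM hd hu e e0.
have e20 : 0 < e ^+ 2 / 4 by rewrite divr_gt0// exprn_gt0.
have [K _ hK] := near_infty_natSinv_lt (PosNum e20).
exists K => i j Ki Kj.
rewrite -(@ltr_pXn2r _ 2%N)// ?nnegrE ?dotnorm_ge0 ?(ltW e0)//.
have Mij : M ((2^-1)%:C *: (u i + u j)).
  apply: subspaceZ => //.
  by apply: subspaceD => //; [case: (hu i)|case: (hu j)].
have := hd _ Mij.
have -> : p - (2^-1)%:C *: (u i + u j) = (2^-1)%:C *: ((p - u i) + (p - u j)).
  rewrite addrACA -opprD scalerBr; congr (_ - _).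
  rewrite -[p in p + p]scale1r -scalerDl scalerA -[LHS]scale1r; congr (_ *: _).
  rewrite -[1]/(1%:C) -rmorphD -rmorphM /=; congr (_%:C); by field.
rewrite dotnormZR gtr0_norm ?invr_gt0// exprMn dotnormD_sqr.
have -> : u i - u j = (p - u j) - (p - u i).
  by rewrite opprB addrC -addrA [RHS]addrC !addrA subrK.
rewrite (dotnormB_sqr (p - u j)) (dotC (p - u j)) Re_conjc.
have /= := hK i Ki; have /= := hK j Kj.
case: (hu i) (hu j) => [_ hi] [_ hj].
have -> : 2^-1 ^+ 2 = 4^-1 :> R by field.
move: hi hj; move: (i.+1%:R^-1) (j.+1%:R^-1) => a b; lra.
Qed.

(** [M] may fail to be closed: [q] is the projection of [p] onto the closure of [M], given with a
    sequence of [M] that tends to it. This form applies to ranges of operators before they are known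
    to be closed or dense. *)
Lemma approx_projection M p : dot_complete -> linear_subspace M ->
  exists u q, [/\ forall k, M (u k), dot_cvg u q &
    forall r, M r -> f (p - q) r = 0].
Proof.
move=> cV subM; pose S := [set N (p - x) ^+ 2 | x in M].
have lS : lbound S 0 by move=> _ [x _ <-]; exact: sqr_ge0.
have S0 : S !=set0 by exists (N (p - 0) ^+ 2); exists 0 => //; case: subM.
have iS : has_inf S by split => //; exists 0.
have dS x : M x -> inf S <= N (p - x) ^+ 2.
  by move=> Mx; apply: ge_inf => //; [case: iS|exists x].
have /choice[u hu] (k : nat) :
    exists x, M x /\ N (p - x) ^+ 2 < inf S + k.+1%:R^-1.
  have k0 : 0 < k.+1%:R^-1 :> R by rewrite invr_gt0.
  by have [_ [x Mx <-]] := inf_adherent k0 iS; exists x.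
have [q uq] := cV _ (dist_minimizing_cauchy subM dS hu).
have lim r : N (p - u k - r) ^+ 2 @[k --> \oo] --> N (p - q - r) ^+ 2.
  have /dot_cvg_norm h : dot_cvg (fun k => p - u k - r) (p - q - r).
    apply: dot_cvg_le uq => k.
    rewrite opprB addrA subrK opprB [p - _]addrC addrAC addrA subrK.
    by rewrite dotnormBC addrC.
  by rewrite !expr2; exact: cvgM.
exists u, q; split=> [k||]; [by case: (hu k)|by []|].
apply: dot_eq0 => // r Mr; apply: orth_of_min => t.
rewrite -(@ler_pXn2r _ 2%N)// ?nnegrE ?dotnorm_ge0//.
(* Both sides are compared with the infimum: [u k] attains it in the limit, and [u k + t r] stays in
   [M], so its squared distance to [p] is never below it. *)
apply: le_trans (_ : inf S <= _).
  have h := lim 0; rewrite subr0 in h.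
  have h' : inf S + k.+1%:R^-1 @[k --> \oo] --> inf S.
    by rewrite -[X in _ --> X]addr0; exact: cvgD (cvg_cst _) (@cvg_harmonic R).
  apply: (ler_cvg_to h h'); apply: nearW => k; rewrite subr0 ltW//.
  by case: (hu k).
apply: (ler_cvg_to (cvg_cst _) (lim _)); apply: nearW => k.
rewrite -addrA -opprD; apply: dS; apply: subspaceD => //.
  by case: (hu k).
exact: subspaceZ.
Qed.
End DotProduct.

(** * The Hilbert spaces H and H x H *)

Section HilbertSquare.
Variables (R : realType) (H : hilbertType R).
Implicit Types (x y : H) (p q : H * H).

Local Notation inner := (@inner R H).

Lemma pinner_bilinear : bilinear_for
  (GRing.Scale.Law.clone _ _ ( *%R ) _)
  (GRing.Scale.Law.clone _ _ (Num.conj \; *%R) _) (@pinner R H).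
Proof.
split=> [q a p p'|q a p p'] /=; rewrite /pinner /=.
  by rewrite !dotDl !dotZl addrACA; congr (_ + _); rewrite -[LHS]mulrDr.
by rewrite !dotDr !dotZr addrACA; congr (_ + _); rewrite -[LHS]mulrDr.
Qed.

HB.instance Definition _ :=
  bilinear_isBilinear.Build R[i] (H * H)%type (H * H)%type R[i] _ _
    (@pinner R H) pinner_bilinear.

Lemma pinner_hermitian p q :
  pinner p q = (-1) ^+ false * Num.conj (pinner q p).
Proof. by rewrite expr0 mul1r /pinner rmorphD /= -!dotC. Qed.

HB.instance Definition _ :=
  isHermitianSesquilinear.Build R[i] (H * H)%type false Num.conj (@pinner R H)
    pinner_hermitian.

Lemma pinner_gt0 p : p != 0 -> 0 < pinner p p.
Proof.
case: p => x y p0; rewrite lt_def addr_ge0 ?dnorm_ge0// andbT.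
rewrite /pinner /= paddr_eq0 ?dnorm_ge0// !dnorm_eq0.
by apply: contra p0 => /andP[/eqP-> /eqP->].
Qed.

HB.instance Definition _ :=
  isDotProduct.Build R[i] (H * H)%type (@pinner R H) pinner_gt0.

Definition pdot : {dot (H * H)%type for Num.conj} := @pinner R H.

Lemma pdotE p q : pdot p q = pinner p q.
Proof. by []. Qed.

Lemma hnormE x : hnorm x = dotnorm inner x.
Proof.
have x0 : 0 <= `|x| by [].
rewrite /dotnorm inner_norm /hnorm.
have -> : `|x| = (complex.Re `|x|)%:C by rewrite RRe_real// ger0_real.
rewrite -rmorphXn /= sqrtr_sqr ger0_norm//.
by move: x0; rewrite lecE => /andP[].
Qed.

Lemma norm_hnorm x : `|x| = (hnorm x)%:C.
Proof. by rewrite /hnorm RRe_real// ger0_real. Qed.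

Lemma pnormE p : pnorm p = dotnorm pdot p.
Proof. by rewrite /pnorm !hnormE -!Re_dotE -ReD. Qed.

Lemma pnorm_sqr p : pnorm p ^+ 2 = hnorm p.1 ^+ 2 + hnorm p.2 ^+ 2.
Proof. by rewrite sqr_sqrtr// addr_ge0 ?sqr_ge0. Qed.

Lemma hnorm1_le p : hnorm p.1 <= pnorm p.
Proof.
rewrite -(@ler_pXn2r _ 2%N)// ?nnegrE ?pnormE ?hnormE ?dotnorm_ge0//.
by rewrite -pnormE -hnormE pnorm_sqr lerDl sqr_ge0.
Qed.

Lemma hnorm2_le p : hnorm p.2 <= pnorm p.
Proof.
rewrite -(@ler_pXn2r _ 2%N)// ?nnegrE ?pnormE ?hnormE ?dotnorm_ge0//.
by rewrite -pnormE -hnormE pnorm_sqr lerDr sqr_ge0.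
Qed.

Lemma pnorm_le p : pnorm p <= hnorm p.1 + hnorm p.2.
Proof.
have h1 : 0 <= hnorm p.1 by rewrite hnormE dotnorm_ge0.
have h2 : 0 <= hnorm p.2 by rewrite hnormE dotnorm_ge0.
rewrite -(@ler_pXn2r _ 2%N)// ?nnegrE ?addr_ge0 ?pnormE ?dotnorm_ge0//.
rewrite -pnormE pnorm_sqr; nra.
Qed.

(** Radii in the topology of [H] are positive elements of [R[i]]; such an element is real, so it can
    be exchanged with its real part. *)
Lemma cvg_dot_cvg (u : nat -> H) x :
  dot_cvg inner u x <-> u k @[k --> \oo] --> x.
Proof.
split=> [/cvgrPdist_lt ux|/cvgrPdist_lt ux]; apply/cvgrPdist_lt => e e0.
  have eE : e = (complex.Re e)%:C by rewrite RRe_real// gtr0_real.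
  move: e0; rewrite eE ltcR => /ux; apply: filterS => k.
  rewrite sub0r normrN ger0_norm ?dotnorm_ge0// -hnormE => uk.
  by rewrite distrC norm_hnorm ltcR.
have := ux e%:C; rewrite ltcR => /(_ e0); apply: filterS => k.
rewrite distrC norm_hnorm ltcR hnormE => uk.
by rewrite sub0r normrN ger0_norm ?dotnorm_ge0.
Qed.

Lemma inner_complete : dot_complete inner.
Proof.
move=> u cu; suff : cvg (u k @[k --> \oo]).
  by move=> /cvg_ex[x ux]; exists x; apply/cvg_dot_cvg.
apply: cauchy_cvg; apply/cauchy_exP => e e0.
have eE : e = (complex.Re e)%:C by rewrite RRe_real// gtr0_real.
move: e0; rewrite eE ltcR => /cu[K hK]; exists (u K).
exists K => // k /= Kk; rewrite -ball_normE /= norm_hnorm ltcR hnormE.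
exact: hK.
Qed.

Lemma dot_cvg_pair (u : nat -> H * H) p : dot_cvg pdot u p <->
  dot_cvg inner (fun k => (u k).1) p.1 /\ dot_cvg inner (fun k => (u k).2) p.2.
Proof.
split=> [h|[h1 h2]].
  split; apply: dot_cvg_le h => k; rewrite -pnormE -hnormE.
    exact: (hnorm1_le (u k - p)).
  exact: (hnorm2_le (u k - p)).
apply: (@dot_cvg_le _ _ _ _ _ (fun k =>
    dotnorm inner ((u k).1 - p.1) + dotnorm inner ((u k).2 - p.2))).
  by move=> k; rewrite -pnormE -!hnormE; exact: (pnorm_le (u k - p)).
by rewrite -[0]addr0; exact: cvgD.
Qed.

Lemma pinner_complete : dot_complete pdot.
Proof.
move=> u cu.
have [x ux] : exists x, dot_cvg inner (fun k => (u k).1) x.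
  apply: inner_complete => e /cu[K hK]; exists K => i j Ki Kj.
  apply: le_lt_trans (hK i j Ki Kj).
  by rewrite -pnormE -hnormE (hnorm1_le (u i - u j)).
have [y uy] : exists y, dot_cvg inner (fun k => (u k).2) y.
  apply: inner_complete => e /cu[K hK]; exists K => i j Ki Kj.
  apply: le_lt_trans (hK i j Ki Kj).
  by rewrite -pnormE -hnormE (hnorm2_le (u i - u j)).
by exists (x, y); apply/dot_cvg_pair.
Qed.

Lemma closed_dot_cvg (M : set (H * H)) (u : nat -> H * H) p : closed M ->
  (forall k, M (u k)) -> dot_cvg pdot u p -> M p.
Proof.
move=> cM Mu /dot_cvg_pair[/cvg_dot_cvg u1 /cvg_dot_cvg u2].
have up : ((u k).1, (u k).2) @[k --> \oo] --> p.
  by case: p u1 u2 => x y u1 u2; exact: cvg_pair.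
apply: (closed_cvg M cM _ _ up); apply: nearW => k.
by rewrite -surjective_pairing.
Qed.

(** If [z] were nonzero, some [x] in [D] would be closer to [z] than [N z]; but [z - x] has inner
    product [N z ^+ 2] with [z], which contradicts Cauchy-Schwarz. *)
Lemma dense_orth (D : set H) z : dense D ->
  (forall x, D x -> inner x z = 0) -> z = 0.
Proof.
move=> dD Dz; apply: (@dotnorm_eq0 _ _ inner); apply: contrapT => /eqP z0.
have {}z0 : 0 < dotnorm inner z by rewrite lt_def z0 dotnorm_ge0.
have e0 : 0 < (dotnorm inner z)%:C by rewrite -[0]/(0%:C) ltcR.
have [x []] : ball z (dotnorm inner z)%:C `&` D !=set0.
  by apply: dD; [exists z; exact: ballxx|exact: ball_open].
rewrite -ball_normE /= norm_hnorm ltcR hnormE => zx Dx.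
have := dot_Re_le inner (z - x) z.
have -> : inner (z - x) z = inner z z by rewrite dotBl (Dz x)// subr0.
rewrite Re_dotE expr2 ler_pM2r//.
by rewrite leNgt zx.
Qed.
End HilbertSquare.

(** * Square root of a contraction *)

Section LinearMap.
Variables (R : realType) (V W : lmodType R[i]).
Implicit Types (C : V -> W) (x y : V) (a : R[i]).

Definition linear_map C :=
  forall a x y, C (a *: x + y) = a *: C x + C y.

Lemma linear_map0 C : linear_map C -> C 0 = 0.
Proof. by move=> /(_ (-1) 0 0); rewrite !scaleN1r !addNr. Qed.

Lemma linear_mapB C x y : linear_map C -> C (x - y) = C x - C y.
Proof. by move=> lC; rewrite addrC -scaleN1r lC scaleN1r addrC. Qed.

End LinearMap.

Section SquareRoot.
Variables (R : realType) (V : lmodType R[i]) (f : {dot V for Num.conj}).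
Hypothesis cV : dot_complete f.
Implicit Types (x y : V) (a : R[i]).

Local Notation N := (dotnorm f).

Definition symmetric_map (C : V -> V) := forall x y, f (C x) y = f x (C y).

Variable C : V -> V.
Hypotheses (lC : linear_map C) (sC : symmetric_map C).
Hypothesis C1 : forall x, N (C x) <= N x.

(* [1 - Y] is a square root of [1 - C] as soon as [Y = (C + Y ^ 2) / 2].  The
   increments of the iteration of this equation from [0] are dominated in norm
   by those of the scalar iteration [sqrt_bound] with [C = 1]. *)
Fixpoint sqrt_iter k x : V :=
  if k is k'.+1 then (2^-1)%:C *: (C x + sqrt_iter k' (sqrt_iter k' x)) else 0.

Fixpoint sqrt_bound k : R :=
  if k is k'.+1 then (1 + sqrt_bound k' ^+ 2) / 2 else 0.

Lemma sqrt_bound01 k : 0 <= sqrt_bound k <= 1.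
Proof. by elim: k => [|k IH] /=; rewrite ?lexx ?ler01//; nra. Qed.

Lemma sqrt_boundS k : sqrt_bound k <= sqrt_bound k.+1.
Proof. have := sqr_ge0 (1 - sqrt_bound k); rewrite /=; nra. Qed.

Lemma sqrt_iter_linear k : linear_map (sqrt_iter k).
Proof.
elim: k => [|k IH] a x y /=; first by rewrite scaler0 addr0.
by rewrite lC !IH !scalerDr !scalerA !(mulrC a) addrACA.
Qed.

Lemma sqrt_iter_symmetric k : symmetric_map (sqrt_iter k).
Proof.
elim: k => [|k IH] x y /=; first by rewrite dot0l dot0r.
by rewrite dotZl dotZr conj_real_complex dotDl dotDr sC !IH.
Qed.

Lemma sqrt_iter_bounded k x : N (sqrt_iter k x) <= sqrt_bound k * N x.
Proof.
elim: k x => [|k IH] x; first by rewrite /= dotnorm0 mul0r.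
rewrite [sqrt_iter _ _]/= dotnormZR gtr0_norm ?invr_gt0//=.
have := dotnormD f (C x) (sqrt_iter k (sqrt_iter k x)).
have := C1 x; have := IH (sqrt_iter k x); have := IH x.
have /andP[q0 q1] := sqrt_bound01 k.
move: (N _) (N _) (N _) (N _) (N _) => n1 n2 n3 n4 n5.
nra.
Qed.

(** With [u] and [w] two successive iterates, the next increment is half of
    [w w - u u = w (w - u) + (w - u) u]. The bounds on the factors multiply as in the scalar
    identity [b ^+ 2 - c ^+ 2 = b (b - c) + (b - c) c]. *)
Lemma sqrt_iter_step k x :
  N (sqrt_iter k.+1 x - sqrt_iter k x) <=
  (sqrt_bound k.+1 - sqrt_bound k) * N x.
Proof.
elim: k x => [|k IH] x.
  have := C1 x; rewrite /= subr0 addr0 dotnormZR gtr0_norm ?invr_gt0//; nra.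
set u := sqrt_iter k; set w := sqrt_iter k.+1.
have -> : sqrt_iter k.+2 x - w x =
    (2^-1)%:C *: (w (w x - u x) + (w (u x) - u (u x))).
  rewrite [w (w x - _)](linear_mapB _ _ (sqrt_iter_linear k.+1)) subrKA.
  by rewrite /w /= -scalerBr opprD addrACA subrr add0r.
rewrite dotnormZR gtr0_norm ?invr_gt0//.
have := dotnormD f (w (w x - u x)) (w (u x) - u (u x)).
have := IH (u x); rewrite -/u -/w.
have := sqrt_iter_bounded k.+1 (w x - u x); rewrite -/w.
have := IH x; rewrite -/u -/w.
have := sqrt_iter_bounded k x; rewrite -/u.
have := sqrt_boundS k; have /andP[q0 q1] := sqrt_bound01 k.
have /andP[q0' q1'] := sqrt_bound01 k.+1.
have -> : sqrt_bound k.+2 = (1 + sqrt_bound k.+1 ^+ 2) / 2 by [].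
have : sqrt_bound k.+1 = (1 + sqrt_bound k ^+ 2) / 2 by [].
move: q0 q1 q0' q1'; move: (sqrt_bound k.+1) (sqrt_bound k) => b c.
move=> c0 c1 b0 b1 E cb h1 h2 h3 h4 h5.
have h6 : b * N (w x - u x) <= b * ((b - c) * N x) by rewrite ler_wpM2l.
have h7 : (b - c) * N (u x) <= (b - c) * (c * N x).
  by rewrite ler_wpM2l// subr_ge0.
rewrite {2}E; lra.
Qed.

Lemma sqrt_iter_dist i j x : (i <= j)%N ->
  N (sqrt_iter j x - sqrt_iter i x) <= (sqrt_bound j - sqrt_bound i) * N x.
Proof.
elim: j => [|j IH].
  by rewrite leqn0 => /eqP->; rewrite !subrr dotnorm0 mul0r.
rewrite leq_eqVlt ltnS => /orP[/eqP->|/IH h].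
  by rewrite !subrr dotnorm0 mul0r.
apply: le_trans (dotnormB_trans f (sqrt_iter j x) _ _) _.
have := sqrt_iter_step j x; lra.
Qed.

Lemma sqrt_bound_le i j : (i <= j)%N -> sqrt_bound i <= sqrt_bound j.
Proof. by move=> ij; have /nondecreasing_seqP := sqrt_boundS; exact. Qed.

(** The scalar sequence is nondecreasing and bounded by 1; beyond an index where it is close to its
    supremum its increments are small, and they dominate those of the iterates. *)
Lemma sqrt_iter_cauchy x : dot_cauchy f (sqrt_iter ^~ x).
Proof.
move=> e e0.
pose S := range sqrt_bound.
have iS : has_sup S.
  split; first by exists (sqrt_bound 0), 0%N.
  by exists 1 => _ [k _ <-]; case/andP: (sqrt_bound01 k).
have x0 : 0 < N x + 1 by rewrite ltr_wpDl ?dotnorm_ge0.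
have e'0 : 0 < e / (N x + 1) by rewrite divr_gt0.
have [_ [K _ <-] hK] := sup_adherent e'0 iS.
exists K => i j Ki Kj.
wlog ij : i j Ki Kj / (i <= j)%N.
  by move=> h; case/orP: (leq_total i j) => /h; [|rewrite dotnormBC]; apply.
rewrite dotnormBC; apply: le_lt_trans (sqrt_iter_dist _ ij) _.
have : sqrt_bound j <= sup S.
  by apply: sup_upper_bound => //; exists j.
have := sqrt_bound_le Ki; have := sqrt_bound_le ij; move=> h1 h2 h3.
apply: le_lt_trans (_ : (sqrt_bound j - sqrt_bound i) * (N x + 1) < _).
  by rewrite ler_wpM2l ?subr_ge0// lerDl.
by rewrite -ltr_pdivlMr//; lra.
Qed.

Lemma sqrt_fixpoint : exists Y : V -> V,
  [/\ linear_map Y, symmetric_map Y, forall x, N (Y x) <= N x &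
      forall x, Y x + Y x = C x + Y (Y x)].
Proof.
have /choice[Y hY] x : exists y, dot_cvg f (sqrt_iter ^~ x) y.
  exact: cV (sqrt_iter_cauchy x).
have sY : symmetric_map Y.
  move=> x y; apply: Re_norm_cvg_unique (dot_cvg_dotl y (hY x)) _.
  under eq_fun do rewrite sqrt_iter_symmetric.
  exact: dot_cvg_dotr x (hY y).
have Y1 x : N (Y x) <= N x.
  apply: (ler_cvg_to (dot_cvg_norm (hY x)) (cvg_cst _)); apply: nearW => k.
  apply: le_trans (sqrt_iter_bounded _ _) _.
  by rewrite ler_piMl ?dotnorm_ge0//; case/andP: (sqrt_bound01 k).
exists Y; split => //.
  move=> a x y; apply: dot_cvg_unique (hY (a *: x + y)) _.
  have h : complex.Re `|a| * N (sqrt_iter k x - Y x) + N (sqrt_iter k y - Y y)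
      @[k --> \oo] --> (0 : R).
    rewrite -[0]addr0 -{1}(mulr0 (complex.Re `|a|)).
    exact: cvgD (cvgM (cvg_cst _) (hY x)) (hY y).
  apply: dot_cvg_le h => k; rewrite sqrt_iter_linear opprD addrACA -scalerBr.
  by apply: le_trans (dotnormD _ _ _) _; rewrite dotnormZ.
move=> x.
have h : dot_cvg f (fun k => sqrt_iter k.+1 x + sqrt_iter k.+1 x)
    (C x + Y (Y x)).
  have h : N (sqrt_iter k x - Y x) + N (sqrt_iter k (Y x) - Y (Y x))
      @[k --> \oo] --> (0 : R).
    by rewrite -[0]addr0; exact: cvgD (hY _) (hY _).
  apply: dot_cvg_le h => k.
  have -> : sqrt_iter k.+1 x + sqrt_iter k.+1 x =
      C x + sqrt_iter k (sqrt_iter k x).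
    rewrite /= -scalerDl -rmorphD /=.
    have -> : 2^-1 + 2^-1 = 1 :> R by field.
    exact: scale1r.
  rewrite opprD addrACA subrr add0r.
  (* The composite of the [k]-th iterate with itself is compared with [Y (Y x)] through the [k]-th
     iterate at [Y x]; iterates are contractions, so the first error is at most that at [x]. *)
  apply: le_trans (dotnormB_trans _ (sqrt_iter k (Y x)) _ _) _.
  rewrite lerD2r -(linear_mapB _ _ (sqrt_iter_linear k)).
  apply: le_trans (sqrt_iter_bounded _ _) _.
  by rewrite ler_piMl ?dotnorm_ge0//; case/andP: (sqrt_bound01 k).
apply: dot_cvg_unique h.
have h : N (sqrt_iter k.+1 x - Y x) + N (sqrt_iter k.+1 x - Y x)
      @[k --> \oo] --> (0 : R).
  have := hY x; rewrite /dot_cvg -cvg_shiftS => {}hY.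
  by rewrite -[0]addr0; exact: cvgD.
by apply: dot_cvg_le h => k; rewrite opprD addrACA dotnormD.
Qed.
End SquareRoot.

(** * Adjoint pairs and the inverse of I + T^* T *)

Section Operators.
Variables (R : realType) (H : hilbertType R).
Implicit Types (S T : operator H) (x y u v w z : H).

Local Notation inner := (@inner R H).
Local Notation N := (dotnorm inner).
Local Notation pdot := (@pdot R H).

Lemma graphE T (p : H * H) : graph T p <-> dom T p.1 /\ T p.1 = p.2.
Proof.
split=> [[x Tx <-] //|[Tp Tpe]]; exists p.1 => //.
by rewrite Tpe -surjective_pairing.
Qed.

(* The rotation [(v, z) |-> (- z, v)] maps the graph of [S] onto the orthogonal
   complement of the graph of [T]. *)
Definition adjoint_pair T S :=
  (forall x v, dom T x -> dom S v -> inner (T x) v = inner x (S v)) /\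
  (forall v z, (forall x, dom T x -> inner (T x) v = inner x z) ->
    dom S v /\ S v = z).

(** Says [S = T^*] and [T = S^*] by relations on graphs, free of the choice made in [adjoint]. It is
    symmetric, so each result on [T] also holds with [T] and [S] exchanged. *)
Definition mutually_adjoint T S := adjoint_pair T S /\ adjoint_pair S T.

Lemma mutually_adjointC T S : mutually_adjoint T S -> mutually_adjoint S T.
Proof. by case. Qed.

Lemma adjoint_pair_linear S T : adjoint_pair S T -> linear_operator T.
Proof.
move=> [ST TS]; split.
  by have [] := TS 0 0 => [x Sx|//]; rewrite !dot0r.
move=> a x y Tx Ty; apply: TS => v Sv.
by rewrite !dotDr !dotZr !ST.
Qed.

Lemma adjoint_pair_closed S T (u : nat -> H * H) p : adjoint_pair S T ->
  (forall k, graph T (u k)) -> dot_cvg pdot u p -> graph T p.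
Proof.
move=> [ST TS] Gu /dot_cvg_pair[u1 u2]; apply/graphE; apply: TS => v Sv.
apply: Re_norm_cvg_unique (dot_cvg_dotr (S v) u1) _.
have E k : inner (S v) (u k).1 = inner v (u k).2.
  by have /graphE[Tu <-] := Gu k; exact: ST.
by under eq_fun do rewrite E; exact: dot_cvg_dotr.
Qed.

Lemma linear_subspace_graph T : linear_operator T -> linear_subspace (graph T).
Proof.
move=> [T0 lT]; split.
  apply/graphE; split => //=.
  by have [_] := lT (-1) 0 0 T0 T0; rewrite !scaleN1r !addNr.
move=> a p q /graphE[Tp Ep] /graphE[Tq Eq]; apply/graphE => /=.
by have [] := lT a p.1 q.1 Tp Tq; rewrite Ep Eq.
Qed.

Lemma linear_operatorB T x y : linear_operator T -> dom T x -> dom T y ->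
  dom T (x - y) /\ T (x - y) = T x - T y.
Proof.
move=> [_ lT] Tx Ty; have := lT (-1) y x Ty Tx.
by rewrite !scaleN1r addrC [- T y + _]addrC.
Qed.

Lemma linear_operatorZ T a x : linear_operator T -> dom T x ->
  dom T (a *: x) /\ T (a *: x) = a *: T x.
Proof.
move=> lT Tx.
have G : graph T (x, T x) by exists x.
by have /graphE := subspaceZ a (linear_subspace_graph lT) G.
Qed.

Lemma closed_subspace_projection (M : set (H * H)) p : linear_subspace M ->
  (forall (u : nat -> H * H) q,
    (forall k, M (u k)) -> dot_cvg pdot u q -> M q) ->
  exists2 q, M q & forall r, M r -> pdot (p - q) r = 0.
Proof.
move=> subM cM; have [u [q [Mu uq orth]]] :=
  approx_projection p (@pinner_complete R H) subM.
by exists q => //; exact: cM uq.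
Qed.

(** Density of the domain makes [adjoint_value] at most a singleton, so the chosen value is the only
    possible one. *)
Lemma adjoint_pair_adjoint T : dense (dom T) -> adjoint_pair T (adjoint T).
Proof.
move=> dT.
have spec v : dom (adjoint T) v -> adjoint_value T v (adjoint T v).
  by move=> [z Tz]; apply: xgetPex; exists z.
split=> [x v Tx /spec|v z Tz]; first exact.
have domv : dom (adjoint T) v by exists z.
split => //; apply/eqP; rewrite -subr_eq0; apply/eqP.
apply: (dense_orth dT) => x Tx.
by rewrite dotBr -(spec _ domv)// -Tz// subrr.
Qed.

(** This is [T = T^**] for closed [T]. Project [(v, z)] onto the graph of [T]; the residual [p] is
    orthogonal to the graph, so [(p.2, - p.1)] lies in the graph of the adjoint. The relation
    assumed on [(v, z)] then makes [p] orthogonal to [(v, z)] too, hence to itself. *)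
Lemma mutually_adjoint_adjoint T :
  closed_densely_defined T -> mutually_adjoint T (adjoint T).
Proof.
move=> [lT dT cT]; have aT := adjoint_pair_adjoint dT; split => //.
have [TT' T'T] := aT; split=> [x v Tx Tv|v z Tz].
  by rewrite dotC -TT'// -dotC.
have [q Gq orth] : exists2 q, graph T q & forall r, graph T r ->
    pdot ((v, z) - q) r = 0.
  apply: closed_subspace_projection; first exact: linear_subspace_graph.
  by move=> u q Gu; exact: closed_dot_cvg.
set p := (v, z) - q.
have [Tp Ep] : dom (adjoint T) p.2 /\ adjoint T p.2 = - p.1.
  apply: T'T => x Tx; rewrite dotNr; apply/eqP; rewrite -addr_eq0 addrC.
  have /orth : graph T (x, T x) by exists x.
  by rewrite -/p => /dot_eq0C/eqP.
have : pdot p ((v, z) - q) = 0.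
  rewrite dotBr (orth _ Gq) subr0 pdotE /pinner /=.
  by rewrite -(Tz _ Tp) Ep dotNl subrr.
move/eqP; rewrite dnorm_eq0 subr_eq0 => /eqP vz.
by move: Gq; rewrite -vz => /graphE.
Qed.

Lemma mutually_adjoint_selfadjoint T :
  closed_densely_defined T -> selfadjoint T -> mutually_adjoint T T.
Proof.
move=> [_ dT _] [[d1 e1] [d2 e2]]; have [TT' T'T] := adjoint_pair_adjoint dT.
suff : adjoint_pair T T by [].
split=> [x v Tx Tv|v z Tz]; first by rewrite TT' ?e1//; exact: d1.
by have [T'v <-] := T'T _ _ Tz; split; [exact: d2|exact: e2].
Qed.

(** * Inverse of [I + S T] and its positive square root *)

Section EnergyForm.
Variables (T S : operator H).
Hypothesis TS : mutually_adjoint T S.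

Let lT : linear_operator T := adjoint_pair_linear TS.2.
Let lS : linear_operator S := adjoint_pair_linear TS.1.

Local Notation B := (addop (scalarop H 1) (mulop S T)).

Lemma energy x w : dom T x -> dom S (T x) -> dom T w ->
  inner w (x + S (T x)) = inner w x + inner (T w) (T x).
Proof. by move=> Tx STx Tw; rewrite dotDr (TS.1.1 w). Qed.

Lemma energy_inj x : dom T x -> dom S (T x) -> x + S (T x) = 0 -> x = 0.
Proof.
move=> Tx STx x0; have := energy Tx STx Tx.
rewrite x0 dot0r !dotE -rmorphD /= => /(@complexI R).
move/esym/eqP; rewrite paddr_eq0 ?sqr_ge0// => /andP[+ _].
by rewrite sqrf_eq0 => /eqP/dotnorm_eq0.
Qed.

(** Let [(x, T x)] be the projection of [(y, 0)] onto the graph of [T]. Orthogonality of the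
    residual reads [inner (T w) (T x) = inner w (y - x)] for all [w] in the domain, that is
    [S (T x) = y - x]. *)
Lemma energy_surj y : exists x, [/\ dom T x, dom S (T x) & x + S (T x) = y].
Proof.
have [q /graphE[Tq Eq] orth] : exists2 q, graph T q & forall r, graph T r ->
    pdot ((y, 0) - q) r = 0.
  apply: closed_subspace_projection; first exact: linear_subspace_graph.
  by move=> u q; apply: adjoint_pair_closed TS.2.
exists q.1.
have [Sq ESq] : dom S q.2 /\ S q.2 = y - q.1.
  apply: TS.1.2 => w Tw.
  have /orth : graph T (w, T w) by exists w.
  move=> /dot_eq0C; rewrite pdotE /pinner /= sub0r dotNr => /eqP.
  by rewrite subr_eq0 => /eqP.
by rewrite Eq ESq addrC subrK.
Qed.

Lemma invop_spec y (x := invop B y) :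
  [/\ dom T x, dom S (T x) & x + S (T x) = y].
Proof.
have : [set x | dom B x /\ B x = y] x.
  apply: xgetPex; have [w [Tw STw E]] := energy_surj y.
  by exists w; split; [split|rewrite /= scale1r].
by move=> [[_ [Tx STx]]] /=; rewrite scale1r.
Qed.

Lemma invop_dom : dom (invop B) = setT.
Proof.
apply/seteqP; split => // y _; have [Tx STx E] := invop_spec y.
by exists (invop B y); [split|rewrite /= scale1r].
Qed.

Lemma invop_eq x y : dom T x -> dom S (T x) -> x + S (T x) = y -> invop B y = x.
Proof.
move=> Tx STx E; have [Tr STr Er] := invop_spec y.
apply/eqP; rewrite -subr_eq0; apply/eqP.
have [Td Ed] := linear_operatorB lT Tr Tx.
have [Sd ESd] := linear_operatorB lS STr STx.
apply: energy_inj; rewrite ?Ed//.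
by rewrite ESd addrACA Er -opprD E subrr.
Qed.

Lemma invop_linear : linear_map (invop B).
Proof.
move=> a x y.
have [Tx STx Ex] := invop_spec x; have [Ty STy Ey] := invop_spec y.
have [Td Ed] := lT.2 a _ _ Tx Ty; have [Sd ESd] := lS.2 a _ _ STx STy.
apply: invop_eq; rewrite ?Ed// ESd -[in RHS]Ex -[in RHS]Ey.
by rewrite scalerDr addrACA.
Qed.

Lemma invop_dot x y :
  inner (invop B x) y = inner (invop B x) (invop B y) +
    inner (T (invop B x)) (T (invop B y)).
Proof.
have [Tx _ _] := invop_spec x; have [Ty STy Ey] := invop_spec y.
by rewrite -{1}Ey energy.
Qed.

Lemma invop_symmetric : symmetric_map inner (invop B).
Proof.
move=> x y; rewrite invop_dot [RHS]dotC [inner (invop B y) _]invop_dot.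
by rewrite rmorphD /= -!dotC.
Qed.

Lemma invop_energy x :
  complex.Re (inner (invop B x) x) =
  N (invop B x) ^+ 2 + N (T (invop B x)) ^+ 2.
Proof. by rewrite invop_dot !dotE -rmorphD. Qed.

Lemma invop_contraction x : N (invop B x) <= N x.
Proof.
have := dot_Re_le inner (invop B x) x; rewrite invop_energy.
have := dotnorm_ge0 inner (invop B x); have := dotnorm_ge0 inner x.
have := sqr_ge0 (N (T (invop B x))).
move: (N (invop B x)) (N x) (N _) => r n t; nra.
Qed.

(** Take [C = 1 - B^-1], a contraction by the energy identity, and [Y] with [2 Y = C + Y ^ 2]. Then
    [A = 1 - Y] satisfies [A ^ 2 = 1 - C = B^-1], and [A] is positive because [Y] is a symmetric
    contraction. *)
Lemma invop_sqrtop : exists A, is_sqrtop (invop B) (Defs.total A).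
Proof.
pose C x := x - invop B x.
have lC : linear_map C.
  by move=> a x y; rewrite /C invop_linear opprD addrACA scalerBr.
have sC : symmetric_map inner C.
  by move=> x y; rewrite /C dotBl dotBr invop_symmetric.
have C1 x : N (C x) <= N x.
  rewrite -(@ler_pXn2r _ 2%N)// ?nnegrE ?dotnorm_ge0//.
  rewrite /C dotnormB_sqr (dotC inner x) Re_conjc invop_energy.
  have := sqr_ge0 (N (T (invop B x))); have := sqr_ge0 (N (invop B x)); lra.
have [Y [lY sY Y1 YY]] := sqrt_fixpoint (@inner_complete R H) lC sC C1.
have lA : linear_map (fun x => x - Y x).
  by move=> a x y; rewrite lY opprD addrACA scalerBr.
exists (fun x => x - Y x); split.
- split => //; first by split => // a x y _ _; split => //; exact: lA.
  apply: (@le_lt_trans _ _ (EFin (2 : R))); last exact: ltry.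
  apply: ge_ereal_sup => _ [x [_ x1] <-]; rewrite lee_fin /=.
  move: x1; rewrite !hnormE => x1.
  apply: le_trans (dotnormD _ _ _) _; rewrite dotnormN.
  have := Y1 x; lra.
- move=> x _ /=; rewrite dotBl.
  have -> : inner (Y x) x = (complex.Re (inner (Y x) x))%:C.
    rewrite RRe_real//; apply/CrealP.
    by rewrite -dotC sY.
  rewrite dotE -rmorphB -[0]/(0%:C) lecR subr_ge0.
  apply: le_trans (dot_Re_le _ _ _) _.
  by rewrite expr2 ler_wpM2r ?dotnorm_ge0.
- have E x : x - Y x - Y (x - Y x) = invop B x.
    rewrite (linear_mapB _ _ lY) opprB addrACA -opprD YY opprD addrACA.
    by rewrite subrr addr0 subKr.
  split; split; rewrite ?invop_dom// => x _.
    exact: esym (E x).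
  exact: E.
Qed.
End EnergyForm.
End Operators.

(** * The isometry onto the graph *)

Section GraphIsometry.
Variables (R : realType) (H : hilbertType R).
Implicit Types (x y u w : H).

Local Notation inner := (@inner R H).
Local Notation N := (dotnorm inner).
Local Notation pdot := (@pdot R H).

(** Polarization at [x + y] and ['i *: x + y]. The square root is specified as bounded and positive
    only, so its symmetry has to come from its real quadratic form. *)
Lemma real_form_symmetric (A : H -> H) : linear_map A ->
  (forall x, inner (A x) x \is Num.real) -> symmetric_map inner A.
Proof.
move=> lA rA x y.
have diag w : inner (A w) w = inner w (A w).
  by rewrite [RHS]dotC; apply/esym/CrealP; exact: rA.
have AD u w : A (u + w) = A u + A w by have := lA 1 u w; rewrite !scale1r.
have := diag (x + y); have := diag ('i%C *: x + y).
rewrite lA AD !dotDl !dotDr !dotZl !dotZr !diag.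
have -> : Num.conj ('i%C : R[i]) = - 'i%C.
  by apply/eqP; rewrite -[Num.conj _]/(conjc _) eq_complex /= oppr0 !eqxx.
move=> /eqP; rewrite -subr_eq0 => /eqP h1 /eqP; rewrite -subr_eq0 => /eqP h2.
have i0 : ('i%C : R[i]) != 0 by rewrite eq_complex /= oner_eq0 andbF.
set a := inner (A x) y in h1 h2 *; set b := inner x (A y) in h1 h2 *.
set c := inner (A y) x in h1 h2 *; set d := inner y (A x) in h1 h2 *.
have e1 : (a - b) + (c - d) = 0 by rewrite -h2; ring.
have e2 : 'i%C * ((a - b) - (c - d)) = 0 by rewrite -h1; ring.
move/eqP: e2; rewrite mulf_eq0 (negPf i0) /= => /eqP e2.
have : 2 * (a - b) = 0 by rewrite -[RHS]addr0 -{1}e1 -{1}e2; ring.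
by move/eqP; rewrite mulf_eq0 pnatr_eq0 /= subr_eq0 => /eqP.
Qed.

Variables (T S : operator H).
Hypothesis TS : mutually_adjoint T S.

Let lT : linear_operator T := adjoint_pair_linear TS.2.

Local Notation B := (addop (scalarop H 1) (mulop S T)).
Local Notation A := (invsqrtop B).

Lemma invsqrtop_spec : is_sqrtop (invop B) A.
Proof. exact: xgetPex (invop_sqrtop TS). Qed.

Lemma invsqrtop_linear : linear_map A.
Proof.
by move=> a x y; have [[_ [_ lA] _] _ _] := invsqrtop_spec; case: (lA a x y).
Qed.

Lemma invsqrtop_sqr x : A (A x) = invop B x.
Proof.
have [_ _ [_ [_ E]]] := invsqrtop_spec.
by apply: E; rewrite invop_dom.
Qed.

Lemma invsqrtop_symmetric : symmetric_map inner A.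
Proof.
apply: real_form_symmetric => [|x]; first exact: invsqrtop_linear.
by have [_ pA _] := invsqrtop_spec; apply: ger0_real; exact: pA.
Qed.

Lemma invsqrtop_contraction x : N (A x) <= N x.
Proof.
rewrite -(@ler_pXn2r _ 2%N)// ?nnegrE ?dotnorm_ge0//.
rewrite -[leLHS]Re_dotE invsqrtop_symmetric invsqrtop_sqr.
apply: le_trans (dot_Re_le _ _ _) _.
by rewrite expr2 ler_wpM2l ?dotnorm_ge0 ?invop_contraction.
Qed.

Lemma invsqrtop_inj x : A x = 0 -> x = 0.
Proof.
move=> Ax0; have [_ _ E] := invop_spec TS x.
have lS := adjoint_pair_linear TS.1.
have lin0 U : linear_operator U -> U 0 = 0.
  by move=> lU; have [_] := linear_operatorB lU lU.1 lU.1; rewrite !subrr.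
by rewrite -E -invsqrtop_sqr Ax0 (linear_map0 invsqrtop_linear) !lin0 ?addr0.
Qed.

(** The residual [w] of the projection onto the closure of the range is orthogonal to [A (A w)], so
    [A w = 0] by symmetry and [w = 0] by injectivity. *)
Lemma invsqrtop_dense_range x :
  exists y : nat -> H, dot_cvg inner (fun k => A (y k)) x.
Proof.
have lA := invsqrtop_linear.
have subM : linear_subspace (range A).
  split; first by exists 0; rewrite ?(linear_map0 lA).
  by move=> a _ _ [u _ <-] [v _ <-]; exists (a *: u + v).
have [u [q [Mu uq orth]]] := approx_projection x (@inner_complete R H) subM.
have /choice[y hy] k : exists y, A y = u k by have [y _ <-] := Mu k; exists y.
exists y; suff -> : x = q by under [X in dot_cvg _ X]eq_fun do rewrite hy.
apply/eqP; rewrite -subr_eq0; apply/eqP; apply: invsqrtop_inj.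
apply: (@dotnorm_eq0 _ _ inner).
apply/eqP; rewrite -sqrf_eq0 -Re_dotE invsqrtop_symmetric.
by rewrite orth//; exists (A (x - q)).
Qed.

Lemma invop_graph y : graph T (invop B y, T (invop B y)).
Proof. by have [Tx _ _] := invop_spec TS y; exists (invop B y). Qed.

(** The isometry [x |-> (A x, T (A x))] at the points [x = A y], where [A x] is [invop B y]. *)
Lemma invop_graph_norm y :
  dotnorm pdot (invop B y, T (invop B y)) = N (A y).
Proof.
apply/eqP; rewrite -(@eqrXn2 _ 2%N)// ?dotnorm_ge0//.
rewrite -pnormE pnorm_sqr !hnormE -(invop_energy TS).
by rewrite -invsqrtop_sqr invsqrtop_symmetric Re_dotE.
Qed.

Lemma invop_graphB y z :
  (invop B y, T (invop B y)) - (invop B z, T (invop B z)) =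
  (invop B (y - z), T (invop B (y - z))).
Proof.
have [Ty _ _] := invop_spec TS y; have [Tz _ _] := invop_spec TS z.
have [_ E] := linear_operatorB lT Ty Tz.
by rewrite (linear_mapB _ _ (invop_linear TS)) E.
Qed.

(** Approximate [x] by [A (y k)]. The isometry on the range of [A] makes the images in the graph a
    Cauchy sequence; the graph is closed, so the limit lies in it, and its first component is [A x]
    because [A] is a contraction. *)
Lemma invsqrtop_graph x :
  graph T (A x, T (A x)) /\ dotnorm pdot (A x, T (A x)) = N x.
Proof.
have [y yx] := invsqrtop_dense_range x.
pose g k := (invop B (y k), T (invop B (y k))).
have cg : dot_cauchy pdot g.
  move=> e e0; have := yx.
  move=> /cvgrPdist_lt/(_ (e / 2)); rewrite divr_gt0// => /(_ isT)[K _ hK].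
  exists K => i j Ki Kj; rewrite invop_graphB invop_graph_norm.
  rewrite (linear_mapB _ _ invsqrtop_linear).
  apply: le_lt_trans (dotnormB_trans _ x _ _) _.
  have := hK i Ki; have := hK j Kj.
  rewrite /= !sub0r !normrN !ger0_norm ?dotnorm_ge0// [N (x - _)]dotnormBC; lra.
have [p gp] := pinner_complete cg.
have Gp : graph T p.
  by apply: (adjoint_pair_closed TS.2) gp => k; exact: invop_graph.
have p1 : p.1 = A x.
  have [g1 _] := (dot_cvg_pair _ _).1 gp; apply: dot_cvg_unique g1 _.
  apply: dot_cvg_le yx => k.
  rewrite -[(g k).1]/(invop B (y k)) -invsqrtop_sqr.
  by rewrite -(linear_mapB _ _ invsqrtop_linear) invsqrtop_contraction.
have [Tp Ep] := (graphE T p).1 Gp.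
have -> : (A x, T (A x)) = p by rewrite -p1 Ep -surjective_pairing.
split => //; apply: (cvg_unique _ (dot_cvg_norm gp)).
  exact: norm_hausdorff.
have := dot_cvg_norm yx; apply: cvg_trans; apply: near_eq_cvg.
by apply: nearW => k; rewrite /g invop_graph_norm.
Qed.

(** The range of the isometry [J] is closed, so the projection of [(u, T u)] onto its closure is
    some [J x0]. It remains to see that the residual [(w, T w)] vanishes. *)
Lemma invsqrtop_graph_onto u : dom T u -> exists x, A x = u.
Proof.
move=> Tu; pose J x := (A x, T (A x)).
have domA x : dom T (A x) by have [/graphE[]] := invsqrtop_graph x.
have lA := invsqrtop_linear.
have lJ : linear_map J.
  move=> a x y; rewrite /J lA; by have [_ ->] := lT.2 a _ _ (domA x) (domA y).
have JB x y : J (x - y) = J x - J y by exact: linear_mapB.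
have subM : linear_subspace (range J).
  split; first by exists 0; rewrite // (linear_map0 lJ).
  by move=> a _ _ [v _ <-] [w _ <-]; exists (a *: v + w).
have [m [q [Mm mq orth]]] :=
  approx_projection (u, T u) (@pinner_complete R H) subM.
have /choice[x hx] k : exists x, J x = m k by have [x _ <-] := Mm k; exists x.
have cx : dot_cauchy inner x.
  move=> e e0; have := mq.
  move=> /cvgrPdist_lt/(_ (e / 2)); rewrite divr_gt0// => /(_ isT)[K _ hK].
  exists K => i j Ki Kj.
  have [_ <-] := invsqrtop_graph (x i - x j); rewrite -/(J _) JB !hx.
  apply: le_lt_trans (dotnormB_trans _ q _ _) _.
  have := hK i Ki; have := hK j Kj.
  rewrite /= !sub0r !normrN !ger0_norm ?dotnorm_ge0//.
  rewrite [dotnorm _ (q - _)]dotnormBC; lra.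
have [x0 xx0] := inner_complete cx.
have qE : q = J x0.
  apply: dot_cvg_unique mq _; apply: dot_cvg_le xx0 => k.
  by rewrite -hx -JB; have [_ ->] := invsqrtop_graph (x k - x0).
exists x0; apply/eqP; rewrite eq_sym -subr_eq0; apply/eqP.
have [Tw Ew] := linear_operatorB lT Tu (domA x0).
set w := u - A x0 in Tw Ew *.
apply: (@dotnorm_eq0 _ _ inner); apply/eqP; rewrite -sqrf_eq0 -Re_dotE.
have [Tr STr Er] := invop_spec TS w.
(* The point [J (A w)] is [(r, T r)] with [r + S (T r) = w]; its inner product with [(w, T w)] is
   therefore [inner w w]. *)
have := orth (J (A w)); rewrite qE => /(_ (ex_intro2 _ _ (A w) I erefl)).
have -> : (u, T u) - J x0 = (w, T w) by rewrite /J Ew.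
rewrite -[pdot _ _]/(inner w (A (A w)) + inner (T w) (T (A (A w)))).
rewrite invsqrtop_sqr -(energy TS)// Er => ->.
by [].
Qed.

Lemma opnorm_sub_invsqrtop (c : R[i]) :
  opnorm (@hnorm R H) (mulop (subop T (scalarop H c)) A) =
  ereal_sup [set (hnorm (g.2 - c *: g.1))%:E | g in
    [set g | graph T g /\ pnorm g <= 1]].
Proof.
rewrite /opnorm; congr ereal_sup; apply/seteqP; split=> [_ [x [_ x1] <-]|].
  exists (A x, T (A x)) => //; split.
    by case: (invsqrtop_graph x).
  by rewrite pnormE; case: (invsqrtop_graph x) => _ ->; rewrite -hnormE.
move=> _ [g [/graphE[Tu Eu] g1] <-].
have [x Ex] := invsqrtop_graph_onto Tu.
have [_ Nx] := invsqrtop_graph x; exists x; last first.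
  by rewrite -[mulop _ _ x]/(T (A x) - c *: A x) Ex Eu.
split; last first.
  by rewrite hnormE -Nx Ex Eu -surjective_pairing -pnormE.
split; first by have [[-> _ _] _ _] := invsqrtop_spec.
split; last by [].
by rewrite -Ex in Tu.
Qed.
End GraphIsometry.

(** * The gap to a scalar operator *)

Section Gap.
Variables (R : realType) (H : hilbertType R).
Implicit Types (S T : operator H) (x y u v w z : H) (p q g h : H * H) (t m : R).

Local Notation inner := (@inner R H).
Local Notation N := (dotnorm inner).
Local Notation pdot := (@pdot R H).

Lemma hnorm_ge0 x : 0 <= hnorm x.
Proof. by rewrite hnormE dotnorm_ge0. Qed.

Lemma pnorm_ge0 p : 0 <= pnorm p.
Proof. by rewrite pnormE dotnorm_ge0. Qed.

Lemma orthoproj_spec T S p : mutually_adjoint T S ->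
  graph T (orthoproj (graph T) p) /\
  forall r, graph T r -> pdot (p - orthoproj (graph T) p) r = 0.
Proof.
move=> TS.
suff : [set q | graph T q /\ forall r, graph T r -> pinner (p - q) r = 0]
    (orthoproj (graph T) p) by [].
apply: xgetPex.
have [q Gq orth] : exists2 q, graph T q & forall r, graph T r ->
    pdot (p - q) r = 0.
  apply: closed_subspace_projection.
    exact: linear_subspace_graph (adjoint_pair_linear TS.2).
  by move=> u q; apply: adjoint_pair_closed TS.2.
by exists q.
Qed.

Lemma orthoproj_unique T S p q : mutually_adjoint T S ->
  graph T q -> (forall r, graph T r -> pdot (p - q) r = 0) ->
  orthoproj (graph T) p = q.
Proof.
move=> TS Gq oq; have [Gq' oq'] := orthoproj_spec p TS.
set q' := orthoproj _ _ in Gq' oq' *.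
have Gd : graph T (q' - q).
  apply: subspaceB Gq' Gq.
  exact: linear_subspace_graph (adjoint_pair_linear TS.2).
apply/eqP; rewrite -subr_eq0 -(dnorm_eq0 pdot); apply/eqP.
have -> : pdot (q' - q) (q' - q) = pdot ((p - q) - (p - q')) (q' - q).
  by congr (pdot _ _); rewrite opprB [RHS]addrC addrA subrK.
by rewrite dotBl oq// oq'// subrr.
Qed.

Lemma graph_orth_adjoint T S p : adjoint_pair T S ->
  (forall r, graph T r -> pdot p r = 0) -> graph S (p.2, - p.1).
Proof.
move=> [_ TS] op; apply/graphE; apply: TS => x Tx.
have /op/dot_eq0C/eqP : graph T (x, T x) by exists x.
by rewrite pdotE /pinner /= dotNr addrC addr_eq0 => /eqP.
Qed.

Lemma adjoint_graph_orth T S h : adjoint_pair T S -> graph S h ->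
  forall r, graph T r -> pdot (- h.2, h.1) r = 0.
Proof.
move=> [TS _] /graphE[Sh <-] r /graphE[Tr Er]; apply: dot_eq0C.
by rewrite pdotE /pinner /= -Er TS// dotNr addNr.
Qed.

Lemma pnorm_rotation p : pnorm (- p.2, p.1) = pnorm p.
Proof. by rewrite /pnorm /= !hnormE dotnormN addrC. Qed.

(** Pythagoras for the graph of the scalar [t]: after division by [1 + t ^+ 2], the two terms are
    the squared distances from [p] to that graph and to its orthogonal complement. *)
Lemma pnorm_scalar_decomp t p :
  hnorm (p.2 - t%:C *: p.1) ^+ 2 + hnorm (p.1 + t%:C *: p.2) ^+ 2 =
  (1 + t ^+ 2) * pnorm p ^+ 2.
Proof.
rewrite pnorm_sqr !hnormE dotnormB_sqr dotnormD_sqr !dotnormZR !exprMn.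
rewrite !real_normK ?num_real// !dotZr !conj_real_complex !ReZ.
rewrite (dotC inner p.2) Re_conjc; ring.
Qed.

Lemma scalarop_selfadjoint t :
  mutually_adjoint (scalarop H t%:C) (scalarop H t%:C).
Proof.
suff : adjoint_pair (scalarop H t%:C) (scalarop H t%:C) by [].
split=> [x v _ _ /=|v z vz]; first by rewrite dotZl dotZr conj_real_complex.
split => //=; apply/eqP; rewrite -subr_eq0 -(dnorm_eq0 inner) dotBr subr_eq0.
by rewrite -vz //= dotZl dotZr conj_real_complex.
Qed.

(** With [P] and [Q] the projections, [P - Q = (1 - Q) P - Q (1 - P)] splits the difference into
    orthogonal parts; the right-hand side is their squared norms times [1 + t ^+ 2]. *)
Lemma gap_sqr T S t p (a := orthoproj (graph T) p) : mutually_adjoint T S ->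
  (1 + t ^+ 2) * pnorm (a - orthoproj (graph (scalarop H t%:C)) p) ^+ 2 =
  hnorm (a.2 - t%:C *: a.1) ^+ 2 +
  hnorm ((p - a).1 + t%:C *: (p - a).2) ^+ 2.
Proof.
move=> TS; have [/graphE[_ Q1]] := orthoproj_spec p (scalarop_selfadjoint t).
set q := orthoproj (graph (scalarop _ _)) p in Q1 * => oq.
(* Orthogonality of [p - q] to the scalar graph is tested at [(w, t w)], where [w] is the very
   vector to be shown zero. *)
have Q2 : (p - q).1 + t%:C *: (p - q).2 = 0.
  apply/eqP; rewrite -(dnorm_eq0 inner).
  set w := (X in inner X X); rewrite {1}/w dotDl dotZl.
  have := oq (w, t%:C *: w).
  rewrite pdotE /pinner /= dotZr conj_real_complex => -> //.
  by exists w.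
rewrite -pnorm_scalar_decomp; congr (_ ^+ 2 + _ ^+ 2).
  by rewrite /= -[q.2]Q1 /= scalerBr opprB subrKA.
pose L (x : H * H) := x.1 + t%:C *: x.2.
have LB (x y : H * H) : L (x - y) = L x - L y.
  by rewrite /L /= scalerBr opprD addrACA.
have -> : (p - a).1 + t%:C *: (p - a).2 = - ((a - q).1 + t%:C *: (a - q).2).
  have -> : p - a = (p - q) - (a - q) by rewrite opprB subrKA.
  by rewrite -[LHS]/(L _) LB /L Q2 sub0r.
by rewrite !hnormE dotnormN.
Qed.

(** Equal to [sqrt (1 + t ^+ 2)] times the norm of [(1 - Q) P], and, by [opnorm_sub_invsqrtop], to
    the operator norm in the theorem. *)
Definition graph_dev T t : \bar R :=
  ereal_sup [set (hnorm (g.2 - t%:C *: g.1))%:E | g in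
    [set g | graph T g /\ pnorm g <= 1]].

Lemma graph_dev_bound T t m g :
  linear_operator T -> (graph_dev T t <= m%:E)%E -> graph T g ->
  hnorm (g.2 - t%:C *: g.1) <= m * pnorm g.
Proof.
move=> lT hm Gg; have [g0|g0] := eqVneq (pnorm g) 0.
  have gE : g = 0 by apply: (@dotnorm_eq0 _ _ pdot); rewrite -pnormE.
  by rewrite g0 mulr0 gE /= scaler0 subr0 hnormE dotnorm0.
have {}g0 : 0 < pnorm g by rewrite lt_def g0 pnorm_ge0.
have Gs : graph T ((pnorm g)^-1%:C *: g).
  exact: subspaceZ (linear_subspace_graph lT) Gg.
have : ((hnorm (((pnorm g)^-1%:C *: g).2 - t%:C *: ((pnorm g)^-1%:C *: g).1))%:E
    <= graph_dev T t)%E.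
  apply: ereal_sup_ubound; exists ((pnorm g)^-1%:C *: g) => //; split => //.
  by rewrite pnormE dotnormZR -pnormE gtr0_norm ?invr_gt0// mulVf// gt_eqF.
move=> /le_trans/(_ hm); rewrite lee_fin /= scalerA mulrC -scalerA -scalerBr.
by rewrite hnormE dotnormZR -hnormE gtr0_norm ?invr_gt0// ler_pdivrMl// mulrC.
Qed.

Lemma ge0_le_sqr (a b : R) : 0 <= a -> 0 <= b -> (a <= b) = (a ^+ 2 <= b ^+ 2).
Proof. by move=> a0 b0; rewrite ler_pXn2r. Qed.

(** The projection [a] lies in the graph of [T] and the rotated residual in the graph of [S]. The
    two terms of [gap_sqr] are at most [m ^+ 2] times the squared norms of [a] and [p - a], whose
    sum is at most 1. *)
Lemma gap_le T S t m : mutually_adjoint T S -> 0 <= m ->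
  (graph_dev T t <= m%:E)%E -> (graph_dev S t <= m%:E)%E ->
  (gap T (scalarop H t%:C) <= ((Num.sqrt (1 + t ^+ 2))^-1 * m)%:E)%E.
Proof.
move=> TS m0 hT hS; apply: ge_ereal_sup => _ [p [_ p1] <-]; rewrite lee_fin /=.
have k0 : 0 < 1 + t ^+ 2 by rewrite ltr_wpDr ?sqr_ge0.
rewrite ge0_le_sqr ?pnorm_ge0 ?mulr_ge0 ?invr_ge0 ?sqrtr_ge0//.
rewrite exprMn exprVn (sqr_sqrtr (ltW k0)) ler_pdivlMl// (gap_sqr _ _ TS).
have [Ga oa] := orthoproj_spec p TS.
set a := orthoproj _ _ in Ga oa *.
have lT := adjoint_pair_linear TS.2; have lS := adjoint_pair_linear TS.1.
have h1 := graph_dev_bound lT hT Ga.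
have h2 := graph_dev_bound lS hS (graph_orth_adjoint TS.1 oa).
have e2 : hnorm (- (p - a).1 - t%:C *: (p - a).2) =
    hnorm ((p - a).1 + t%:C *: (p - a).2).
  by rewrite -opprD !hnormE dotnormN.
have e3 : pnorm ((p - a).2, - (p - a).1) = pnorm (p - a).
  by rewrite /pnorm !hnormE [_.2]/= [_.1]/= dotnormN addrC.
move: h2; rewrite [_.2]/= [_.1]/= e2 e3 => h2.
have pyth : pnorm a ^+ 2 + pnorm (p - a) ^+ 2 <= 1.
  have := dotnormD_orth (oa _ Ga); rewrite subrK -!pnormE addrC => <-.
  by rewrite expr_le1 ?pnorm_ge0.
have s1 : hnorm (a.2 - t%:C *: a.1) ^+ 2 <= (m * pnorm a) ^+ 2.
  by rewrite -ge0_le_sqr ?hnorm_ge0 ?mulr_ge0 ?pnorm_ge0.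
have s2 : hnorm ((p - a).1 + t%:C *: (p - a).2) ^+ 2 <=
    (m * pnorm (p - a)) ^+ 2.
  by rewrite -ge0_le_sqr ?hnorm_ge0 ?mulr_ge0 ?pnorm_ge0.
apply: le_trans (lerD s1 s2) _.
by rewrite !exprMn -mulrDr ler_piMr ?sqr_ge0.
Qed.

(** One term of [gap_sqr] vanishes on suitable vectors: the second for [p] in the graph of [T], the
    first for [p] a rotated vector of the graph of [S], whose projection onto the graph of [T] is
    0. *)
Lemma gap_ge T S t : mutually_adjoint T S ->
  (graph_dev T t <= (Num.sqrt (1 + t ^+ 2))%:E * gap T (scalarop H t%:C))%E /\
  (graph_dev S t <= (Num.sqrt (1 + t ^+ 2))%:E * gap T (scalarop H t%:C))%E.
Proof.
move=> TS.
have k0 : 0 < 1 + t ^+ 2 by rewrite ltr_wpDr ?sqr_ge0.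
have lT := adjoint_pair_linear TS.2; have lS := adjoint_pair_linear TS.1.
pose D p := orthoproj (graph T) p - orthoproj (graph (scalarop H t%:C)) p.
have ub p : pnorm p <= 1 -> ((Num.sqrt (1 + t ^+ 2) * pnorm (D p))%:E <=
    (Num.sqrt (1 + t ^+ 2))%:E * gap T (scalarop H t%:C))%E.
  move=> p1; rewrite EFinM lee_wpmul2l ?lee_fin ?sqrtr_ge0//.
  by apply: ereal_sup_ubound; exists p.
have sqrtE (x b : R) : 0 <= x -> 0 <= b -> (1 + t ^+ 2) * x ^+ 2 = b ^+ 2 ->
    b = Num.sqrt (1 + t ^+ 2) * x.
  move=> x0 b0 E; apply/eqP; rewrite -(@eqrXn2 _ 2%N)// ?mulr_ge0 ?sqrtr_ge0//.
  by rewrite exprMn (sqr_sqrtr (ltW k0)) E.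
split; apply: ge_ereal_sup => _ [g [Gg g1] <-].
  have E := gap_sqr t g TS; move: E (ub g g1); rewrite /D.
  rewrite (orthoproj_unique TS Gg); last by move=> r _; rewrite subrr dot0l.
  have -> : (g - g).1 + t%:C *: (g - g).2 = 0 by rewrite subrr /= scaler0 addr0.
  have -> : hnorm (0 : H) = 0 by rewrite hnormE dotnorm0.
  rewrite expr0n [(2 == 0)%:R]/= addr0.
  by move=> /sqrtE <- //; rewrite ?hnorm_ge0 ?pnorm_ge0.
pose p := (- g.2, g.1); have op := adjoint_graph_orth TS.1 Gg.
have p1 : pnorm p <= 1 by rewrite pnorm_rotation.
have E := gap_sqr t p TS; move: E (ub p p1); rewrite /D.
have G0 : graph T 0 by case: (linear_subspace_graph lT).
rewrite (orthoproj_unique TS G0); last by move=> r Gr; rewrite subr0 op.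
have -> : (0 : H * H).2 - t%:C *: (0 : H * H).1 = 0 by rewrite /= scaler0 subr0.
have -> : hnorm (0 : H) = 0 by rewrite hnormE dotnorm0.
rewrite expr0n [(2 == 0)%:R]/= !add0r subr0.
have -> : p.1 + t%:C *: p.2 = - (g.2 - t%:C *: g.1).
  by rewrite /p /= opprB addrC.
rewrite hnormE dotnormN -hnormE.
by move=> /sqrtE <- //; rewrite ?hnorm_ge0 ?pnorm_ge0.
Qed.

Lemma graph_dev_ge0 T t : linear_operator T -> (0 <= graph_dev T t)%E.
Proof.
move=> lT; apply: ereal_sup_ubound; exists 0.
  split; first by case: (linear_subspace_graph lT).
  by rewrite pnormE dotnorm0.
by rewrite /= scaler0 subr0 hnormE dotnorm0.
Qed.

Lemma gap_graph_dev T S t : mutually_adjoint T S ->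
  gap T (scalarop H t%:C) =
  (((Num.sqrt (1 + t ^+ 2))^-1)%:E * maxe (graph_dev T t) (graph_dev S t))%E.
Proof.
move=> TS; have k0 : 0 < Num.sqrt (1 + t ^+ 2).
  by rewrite sqrtr_gt0 ltr_wpDr ?sqr_ge0.
have lT := adjoint_pair_linear TS.2.
have [g1 g2] := gap_ge t TS.
apply/le_anti/andP; split; last first.
  by rewrite lee_pdivrMl// ge_max g1 g2.
have : (0 <= maxe (graph_dev T t) (graph_dev S t))%E.
  by rewrite le_max graph_dev_ge0.
case E : (maxe _ _) => [m| |]//; last first.
  by move=> _; rewrite gt0_muley ?lte_fin ?invr_gt0// leey.
rewrite lee_fin => m0.
by apply: gap_le TS _ _ _ => //; rewrite -E le_max lexx ?orbT.
Qed.
End Gap.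

(** * Bounded invertibility from lower bounds on the graphs *)

Section Resolvent.
Variables (R : realType) (H : hilbertType R).
Implicit Types (S T : operator H) (x y u v w z : H) (p q g h : H * H) (t m : R).

Local Notation inner := (@inner R H).
Local Notation N := (dotnorm inner).
Local Notation pdot := (@pdot R H).

Lemma graph_dev_lower T t m : linear_operator T -> 0 <= m ->
  (graph_dev T t <= m%:E)%E -> forall x, dom T x ->
  (1 + t ^+ 2 - m ^+ 2) * pnorm (x, T x) ^+ 2 <= hnorm (x + t%:C *: T x) ^+ 2.
Proof.
move=> lT m0 hT x Tx.
have G : graph T (x, T x) by exists x.
have := graph_dev_bound lT hT G.
rewrite ge0_le_sqr ?hnorm_ge0 ?mulr_ge0 ?pnorm_ge0// exprMn.
have := pnorm_scalar_decomp t (x, T x); rewrite [_.1]/= [_.2]/=; lra.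
Qed.

(** The lower bound yields injectivity of [T - l], closedness of its range and boundedness of its
    inverse. Since [l] is real, a vector orthogonal to the range is an eigenvector of [S] for [l],
    hence 0, so the range is all of [H]. *)
Lemma resolvent_of_bounds T S (l : R) (e : R) : mutually_adjoint T S -> 0 < e ->
  (forall x, dom T x -> e * pnorm (x, T x) <= hnorm (T x - l%:C *: x)) ->
  (forall v, dom S v -> S v = l%:C *: v -> v = 0) ->
  resolvent_set T l%:C.
Proof.
move=> TS e0 lower inj; have lT := adjoint_pair_linear TS.2.
set U := subop T (scalarop H l%:C).
have domU x : dom T x -> dom U x by [].
have UE x : U x = T x - l%:C *: x by [].
have lU a x y : dom T x -> dom T y ->
    dom T (a *: x + y) /\ U (a *: x + y) = a *: U x + U y.
  move=> Tx Ty; have [Td Ed] := lT.2 a _ _ Tx Ty; split => //.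
  by rewrite !UE Ed !scalerDr scalerN !scalerA mulrC opprD addrACA.
have UB x y : dom T x -> dom T y -> U (x - y) = U x - U y.
  move=> Tx Ty; have [_] := lU (-1) y x Ty Tx.
  by rewrite !scaleN1r addrC [- U y + _]addrC.
have Uinj x : dom T x -> U x = 0 -> x = 0.
  move=> Tx Ux0; have := lower _ Tx; rewrite -UE Ux0 hnormE dotnorm0 => h.
  apply: (@dotnorm_eq0 _ _ inner); apply/le_anti; rewrite dotnorm_ge0 andbT.
  rewrite -hnormE; apply: le_trans (hnorm1_le (x, T x)) _.
  by rewrite -(ler_pM2l e0) mulr0.
have Usurj y : exists x, dom T x /\ U x = y.
  have subM : linear_subspace (U @` dom T).
    split.
      exists 0; first exact: lT.1.
      by have := UB _ _ lT.1 lT.1; rewrite !subrr.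
    move=> a _ _ [u Tu <-] [v Tv <-].
    by have [Td Ed] := lU a _ _ Tu Tv; exists (a *: u + v).
  have [m [q [Mm mq orth]]] := approx_projection y (@inner_complete R H) subM.
  have /choice[x hx] k : exists x, dom T x /\ U x = m k.
    by have [x Tx <-] := Mm k; exists x.
  (* The lower bound controls the whole pair [(x, T x)], so convergence of [U (x k)] makes the pairs
     Cauchy in the graph. *)
  have cg : dot_cauchy pdot (fun k => (x k, T (x k))).
    move=> d d0; have := mq.
    have d'0 : 0 < e * d / 2 by rewrite divr_gt0 ?mulr_gt0.
    move=> /cvgrPdist_lt/(_ _ d'0)[K _ hK]; exists K => i j Ki Kj.
    have [[Ti Ei] [Tj Ej]] := (hx i, hx j).
    have [Td Ed] := linear_operatorB lT Ti Tj.
    have -> : (x i, T (x i)) - (x j, T (x j)) = (x i - x j, T (x i - x j)).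
      by rewrite Ed.
    rewrite -pnormE -(ltr_pM2l e0); apply: le_lt_trans (lower _ Td) _.
    rewrite -UE UB// Ei Ej hnormE.
    apply: le_lt_trans (dotnormB_trans _ q _ _) _.
    have := hK i Ki; have := hK j Kj.
    rewrite /= !sub0r !normrN !ger0_norm ?dotnorm_ge0//.
    rewrite [N (q - _)]dotnormBC; lra.
  have [g gg] := pinner_complete cg.
  have /graphE[Tg Eg] : graph T g.
    apply: (adjoint_pair_closed TS.2) gg => k.
    by exists (x k) => //; case: (hx k).
  have [/= g1 g2] := (dot_cvg_pair _ _).1 gg.
  have qU : q = U g.1.
    apply: dot_cvg_unique mq _.
    have h : N (T (x k) - g.2) + `|l| * N (x k - g.1) @[k --> \oo] --> (0 : R).
      rewrite -[0]addr0 -{2}(mulr0 `|l|).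
      exact: cvgD g2 (cvgM (cvg_cst _) g1).
    apply: dot_cvg_le h => k; have [_ <-] := hx k.
    have -> : U (x k) - U g.1 = (T (x k) - g.2) - l%:C *: (x k - g.1).
      by rewrite !UE Eg scalerBr !opprD addrACA.
    by apply: le_trans (dotnormD _ _ _) _; rewrite dotnormN dotnormZR.
  have yq : y - q = 0.
    have [Sv Ev] : dom S (y - q) /\ S (y - q) = l%:C *: (y - q).
      apply: TS.1.2 => w Tw.
      have : inner (y - q) (U w) = 0 by apply: orth; exists w.
      move=> /dot_eq0C/eqP; rewrite UE dotBl subr_eq0 => /eqP ->.
      by rewrite dotZl dotZr conj_real_complex.
    exact: inj.
  exists g.1; split => //; apply: etrans (esym qU) _.
  by apply/esym/eqP; rewrite -subr_eq0 yq.
have spec y : dom T (invop U y) /\ U (invop U y) = y.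
  have : [set x | dom U x /\ U x = y] (invop U y).
    by apply: xgetPex; have [x [Tx Ux]] := Usurj y; exists x.
  by move=> [[Tx _] Ux].
have Uinj2 x y : dom T x -> dom T y -> U x = U y -> x = y.
  move=> Tx Ty E; apply/eqP; rewrite -subr_eq0; apply/eqP.
  have [Td _] := linear_operatorB lT Tx Ty.
  by apply: Uinj => //; rewrite UB// E subrr.
split.
  by move=> x y /set_mem Tx /set_mem Ty; exact: Uinj2.
split.
- apply/seteqP; split => // y _; have [Tx Ux] := spec y.
  by exists (invop U y).
- split.
    exists 0; first by split => //; exact: lT.1.
    by have := UB _ _ lT.1 lT.1; rewrite !subrr.
  move=> a x y _ _; have [Tx Ux] := spec x; have [Ty Uy] := spec y.
  have [Td Ed] := lU a _ _ Tx Ty; have [Tz Uz] := spec (a *: x + y).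
  split; last by apply: Uinj2 => //; rewrite Uz Ed Ux Uy.
  by exists (invop U (a *: x + y)).
- apply: (@le_lt_trans _ _ (EFin e^-1)); last exact: ltry.
  apply: ge_ereal_sup => _ [y [_ y1] <-]; rewrite lee_fin.
  have [Tx Ux] := spec y; have := lower _ Tx; rewrite -UE Ux => h.
  rewrite -(ler_pM2l e0) divff ?gt_eqF//; apply: le_trans y1; apply: le_trans h.
  by rewrite ler_pM2l// (hnorm1_le (invop U y, _)).
Qed.
End Resolvent.

(** * Comparison of the gap with 1 and the main result *)

(** Dropping the second term of [pnorm_scalar_decomp] bounds [graph_dev] by [sqrt (1 + t ^+ 2)] on
    both graphs. *)
Lemma gap_le1 (R : realType) (H : hilbertType R) (T S : operator H) (t : R) :
  mutually_adjoint T S -> (gap T (scalarop H t%:C) <= 1)%E.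
Proof.
move=> TS; have k0 : 0 < 1 + t ^+ 2 by rewrite ltr_wpDr ?sqr_ge0.
have dev_le (U : operator H) :
    (graph_dev U t <= (Num.sqrt (1 + t ^+ 2))%:E)%E.
  apply: ge_ereal_sup => _ [g [Gg g1] <-]; rewrite lee_fin.
  rewrite ge0_le_sqr ?hnorm_ge0 ?sqrtr_ge0// (sqr_sqrtr (ltW k0)).
  have := pnorm_scalar_decomp t g.
  have := sqr_ge0 (hnorm (g.1 + t%:C *: g.2)).
  have : pnorm g ^+ 2 <= 1 by rewrite expr_le1 ?pnorm_ge0.
  move: k0 (pnorm g ^+ 2) (hnorm _ ^+ 2) (hnorm _ ^+ 2) => k0 a b c; nra.
have := gap_le TS (sqrtr_ge0 _) (dev_le T) (dev_le S).
by rewrite mulVf// gt_eqF// sqrtr_gt0.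
Qed.

(* If the gap is less than 1, then on the unit spheres of both graphs
   [|y - t x|] stays below its maximal value [sqrt (1 + t ^ 2)] by a uniform
   factor, so the complementary quantity [|x + t y|] is bounded below there. *)
Lemma resolvent_of_gap_lt1 (R : realType) (H : hilbertType R)
    (T S : operator H) (t : R) : mutually_adjoint T S -> 0 < t ->
  (gap T (scalarop H t%:C) < 1)%E -> resolvent_set T (- t^-1)%:C.
Proof.
move=> TS t0; have k0 : 0 < 1 + t ^+ 2 by rewrite ltr_wpDr ?sqr_ge0.
have lT := adjoint_pair_linear TS.2; have lS := adjoint_pair_linear TS.1.
have [devT devS] := gap_ge t TS.
have : (0 <= gap T (scalarop H t%:C))%E.
  have s0 : 0 < Num.sqrt (1 + t ^+ 2) by rewrite sqrtr_gt0.
  by rewrite -(@pmule_rge0 _ (Num.sqrt (1 + t ^+ 2))%:E) ?lte_fin//;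
     apply: le_trans devT; exact: graph_dev_ge0.
case: (gap _ _) devT devS => [th| |]// devT devS.
rewrite lee_fin lte_fin => th0 th1.
set m := Num.sqrt (1 + t ^+ 2) * th.
have m0 : 0 <= m by rewrite mulr_ge0 ?sqrtr_ge0.
(* This equals [(1 + t ^+ 2) * (1 - th ^+ 2)], positive exactly because the gap [th] is below 1. *)
pose d := 1 + t ^+ 2 - m ^+ 2.
have d0 : 0 < d.
  rewrite /d /m exprMn (sqr_sqrtr (ltW k0)) -{1}[1 + t ^+ 2]mulr1 -mulrBr.
  by rewrite mulr_gt0// subr_gt0 expr_lt1.
have lowT := graph_dev_lower lT m0 devT.
have lowS := graph_dev_lower lS m0 devS.
apply: (@resolvent_of_bounds _ _ _ _ _ (Num.sqrt d / t) TS).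
- by rewrite divr_gt0 ?sqrtr_gt0.
- move=> x Tx; have -> : T x - (- t^-1)%:C *: x = t^-1%:C *: (x + t%:C *: T x).
    rewrite scalerDr scalerA -rmorphM mulVf ?gt_eqF//= scale1r addrC.
    by rewrite rmorphN scaleNr opprK.
  rewrite hnormE dotnormZR -hnormE gtr0_norm ?invr_gt0// mulrAC mulrC.
  rewrite ler_pM2l ?invr_gt0//.
  rewrite ge0_le_sqr ?hnorm_ge0 ?mulr_ge0 ?sqrtr_ge0 ?pnorm_ge0//.
  by rewrite exprMn (sqr_sqrtr (ltW d0)) lowT.
(* An eigenvector of [S] for [- t^-1] has [v + t S v = 0], so the lower bound on the graph of [S]
   forces it to vanish. *)
- move=> v Sv Ev; have := lowS v Sv.
  have -> : v + t%:C *: S v = 0.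
    rewrite Ev scalerA -rmorphM mulrN mulfV ?gt_eqF//= rmorphN scaleNr.
    by apply/eqP; rewrite subr_eq0 scale1r.
  rewrite [hnorm 0]hnormE dotnorm0 expr0n -/d pmulr_rle0// => h.
  have /(@dotnorm_eq0 _ _ (@pdot R H))[//] : dotnorm (@pdot R H) (v, S v) = 0.
  by apply/eqP; rewrite -pnormE -sqrf_eq0 eq_le h sqr_ge0.
Qed.

Theorem proposition4p1 (R : realType) (H : hilbertType R)
    (infdimH : infinite_dimensional H) (T : operator H)
    (T_CH : closed_densely_defined T) (T_sym : symmetric_operator T)
    (n : nat) (n_gt0 : (0 < n)%N) :
  let I := scalarop H 1 in
  let nI := scalarop H n%:R in
  [/\ gap T nI =
        (((Num.sqrt (1 + n%:R ^+ 2))^-1)%:E *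
         maxe
           (opnorm (@hnorm R H)
              (mulop (subop T nI)
                     (invsqrtop (addop I (mulop (adjoint T) T)))))
           (opnorm (@hnorm R H)
              (mulop (subop (adjoint T) nI)
                     (invsqrtop (addop I (mulop T (adjoint T)))))))%E,
      selfadjoint T ->
        gap T nI =
          (((Num.sqrt (1 + n%:R ^+ 2))^-1)%:E *
           opnorm (@hnorm R H)
             (mulop (subop T nI)
                    (invsqrtop (addop I (mulop T T)))))%E
    & spectrum T (- n%:R^-1) -> gap T nI = 1%E].
Proof.
move=> I nI.
have TS := mutually_adjoint_adjoint T_CH.
have nE : n%:R = (n%:R : R)%:C by rewrite rmorph_nat.
rewrite /I /nI nE; split=> [|sT|sp].
- by rewrite (gap_graph_dev _ TS) (opnorm_sub_invsqrtop TS)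
    (opnorm_sub_invsqrtop (mutually_adjointC TS)).
(* The general formula is reused with [T] as its own partner, so that the two entries of the maximum
   coincide. *)
- have TT := mutually_adjoint_selfadjoint T_CH sT.
  by rewrite (gap_graph_dev _ TT) maxxx (opnorm_sub_invsqrtop TT).
(* Contraposition: the gap is at most 1, and a strictly smaller value would put [- n^-1] in the
   resolvent set. *)
- apply/eqP; rewrite eq_le (gap_le1 _ TS) leNgt /=; apply/negP => lt1.
  apply: sp; rewrite -fmorphV -rmorphN.
  by apply: resolvent_of_gap_lt1 TS _ lt1; rewrite ltr0n.
Qed.
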